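(* Let $(M,L)$ be a Finsler manifold admitting a concurrent $\pi$-vector field $\overline{\zeta}$, and let $(M,\widetilde{L})$ be the Finsler manifold obtained from it by the energy $\beta$-change $\widetilde{L}^{2}=L^{2}+B^{2}$, where $B:=g(\overline{\zeta},\overline{\eta})$. Put $p^{2}:=g(\overline{\zeta},\overline{\zeta})$. Then the associated Berwald connections $D^{\circ}$ and $\widetilde{D^{\circ}}$ are related, for all vector fields $X,Y$ on $\mathcal{T}M$, by $$\widetilde{D^{\circ}}_{X}\rho Y=D^{\circ}_{X}\rho Y-\frac{g(\rho X,\rho Y)}{1+p^{2}}\,\overline{\zeta}.$$ In particular, for all $\overline{X},\overline{Y}\in\mathfrak{X}(\pi(M))$: (a) $\widetilde{D^{\circ}}_{\gamma\overline{X}}\overline{Y}=D^{\circ}_{\gamma\overline{X}}\overline{Y}$; (b) $\widetilde{D^{\circ}}_{\widetilde{\beta}\overline{X}}\overline{Y}=D^{\circ}_{\beta\overline{X}}\overline{Y}-U^{\circ}(\overline{X},\overline{Y})$, where $U^{\circ}(\overline{X},\overline{Y})=\dfrac{g(\overline{X},\overline{Y})}{1+p^{2}}\,\overline{\zeta}-\dfrac{g(\overline{X},\overline{\eta})}{1+p^{2}}\,D^{\circ}_{\gamma\overline{\zeta}}\overline{Y}$.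
   Context: $M$ is a real paracompact smooth manifold of finite dimension $n$; all objects are $C^\infty$. $\pi:\mathcal{T}M\to M$ is the bundle of nonzero tangent vectors, $\pi^{-1}(TM)\to\mathcal{T}M$ the pullback of $TM$ by $\pi$. Sections of $\pi^{-1}(TM)$ are called $\pi$-vector fields, are written with bars, and form the module $\mathfrak{X}(\pi(M))$. The fundamental $\pi$-vector field is $\overline{\eta}(u)=(u,u)$. $\rho:T(\mathcal{T}M)\to\pi^{-1}(TM)$ is $\rho=(\pi_{\mathcal{T}M},d\pi)$, and $\gamma:\pi^{-1}(TM)\to T(\mathcal{T}M)$ is the vertical lift $\gamma(u,v)=j_u(v)$, with $j_u:T_{\pi(u)}M\to T_u(T_{\pi(u)}M)$ the natural isomorphism. $(M,L)$ is a Finsler manifold with Finsler metric $g$ on $\pi^{-1}(TM)$ (locally $g_{ij}=\frac12\partial^2L^2/\partial y^i\partial y^j$). For a linear connection $D$ on $\pi^{-1}(TM)$ its connection map is $K(X)=D_X\overline{\eta}$; $D$ is regular if $T_u(\mathcal{T}M)=V_u(\mathcal{T}M)\oplus\ker K_u$ for all $u$ ($V$ the vertical bundle), and then its horizontal map is $\beta:=(\rho|_{\ker K})^{-1}$. The torsion is $\mathbf{T}(X,Y)=D_X\rho Y-D_Y\rho X-\rho[X,Y]$, with $Q(\overline{X},\overline{Y})=\mathbf{T}(\beta\overline{X},\beta\overline{Y})$ and $T(\overline{X},\overline{Y})=\mathbf{T}(\gamma\overline{X},\beta\overline{Y})$. The curvature is $\mathbf{K}(X,Y)\rho Z=-D_XD_Y\rho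 Z+D_YD_X\rho Z+D_{[X,Y]}\rho Z$, with $P(\overline{X},\overline{Y})\overline{Z}=\mathbf{K}(\beta\overline{X},\gamma\overline{Y})\overline{Z}$ and $\widehat{P}(\overline{X},\overline{Y})=P(\overline{X},\overline{Y})\overline{\eta}$. The Cartan connection $\nabla$ is the unique regular connection on $\pi^{-1}(TM)$ with $\nabla g=0$, $Q=0$ and $g(T(\overline{X},\overline{Y}),\overline{Z})=g(T(\overline{X},\overline{Z}),\overline{Y})$. A $\pi$-vector field $\overline{\zeta}$ is concurrent if $\nabla_{\beta\overline{X}}\overline{\zeta}=-\overline{X}$ and $\nabla_{\gamma\overline{X}}\overline{\zeta}=0$ for all $\overline{X}$. The Berwald connection $D^{\circ}$ of $(M,L)$ is given by $D^{\circ}_X\overline{Y}=\nabla_X\overline{Y}+\widehat{P}(\rho X,\overline{Y})-T(KX,\overline{Y})$, with $\widehat{P},T,K$ those of the Cartan connection $\nabla$ (equivalently, it is the unique regular torsion-free connection on $\pi^{-1}(TM)$ for which $L$ is horizontally constant and whose own $\widehat{P^{\circ}}$ vanishes); it has the same horizontal map $\beta$ as $\nabla$. $\widetilde{D^{\circ}}$ and $\widetilde{\beta}$ are the corresponding objects for $\widetilde{L}$. *)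

(* Defs.v *)
From HB Require Import structures.
From mathcomp Require Import all_boot all_order all_algebra.
From mathcomp Require Import all_classical all_reals all_analysis.

Set Implicit Arguments.
Unset Strict Implicit.
Unset Printing Implicit Defensive.

Import Order.TTheory GRing.Theory Num.Theory.
Import numFieldNormedType.Exports.

Local Open Scope classical_set_scope.
Local Open Scope ring_scope.

(** ** Smooth maps between open sets of normed spaces *)

Section SmoothMaps.
Context {R : realType} {V W : normedModType R}.

Fixpoint Ck (k : nat) (O : set V) (f : V -> W) : Prop :=
  match k with
  | 0 => forall x, O x -> {for x, continuous f}
  | k'.+1 => (forall x, O x -> differentiable f x) /\
             (forall v, Ck k' O (fun x => 'd f x v))
  end.

Definition smooth_on (O : set V) (f : V -> W) : Prop := forall k, Ck k O f.

End SmoothMaps.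

(** ** Atlases and manifolds *)

(* An atlas is bare data; the axioms are those of [smooth_manifold] below.
   Only the values of [coord i] on [dom i] matter. [chart_at] chooses a chart
   around each point. *)
Record atlas (R : realType) (n : nat) (T : Type) := Atlas {
  chart_index : Type;
  dom : chart_index -> set T;
  coord : chart_index -> T -> 'rV[R]_n;
  chart_at : T -> chart_index }.

Section Charts.
Context {R : realType} {n : nat} {T : Type} (A : atlas R n T).

(* [loc i F] is F \o (coord i)^-1 on the image of the chart i, and 0 outside. *)
Definition loc (i : chart_index A) (V : normedModType R) (F : T -> V) (x : 'rV[R]_n)
    : V :=
  xget 0 (F @` [set p | dom i p /\ coord i p = x]).

Definition smooth_in (i : chart_index A) (V : normedModType R) (F : T -> V) : Prop :=
  smooth_on (coord i @` dom i) (loc i F).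

Definition smooth_fun (F : T -> R) : Prop := forall i, smooth_in i (F : T -> R^o).

(* A tangent vector is the family of its components in all the charts; the
   component in a chart that does not contain the base point is 0, so that
   equal tangent vectors are equal families. *)
Definition vec : lmodType R := chart_index A -> 'rV[R]_n.

Definition tangent (p : T) (v : vec) : Prop :=
  (forall i, ~ dom i p -> v i = 0) /\
  (forall i j, dom i p -> dom j p ->
     v j = 'd (loc i (coord j)) (coord i p) (v i)).

Definition vfield_in (i : chart_index A) (X : T -> vec) : Prop :=
  (forall p, dom i p -> tangent p (X p)) /\ smooth_in i (fun p => X p i).

Definition vfield (X : T -> vec) : Prop := forall i, vfield_in i X.

(* The derivative of the function F along the tangent vector v at p. *)
Definition dir (p : T) (v : vec) (F : T -> R) : R :=
  'd (loc (chart_at A p) (F : T -> R^o)) (coord (chart_at A p) p)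
    (v (chart_at A p)).

Definition bracket (X Y : T -> vec) : T -> vec := fun p i =>
  'd (loc i (fun q => Y q i)) (coord i p) (X p i)
  - 'd (loc i (fun q => X q i)) (coord i p) (Y p i).

End Charts.

Definition paracompact (M : topologicalType) : Prop :=
  forall U : set (set M),
    (forall O, U O -> open O) -> \bigcup_(O in U) O = setT ->
  exists V : set (set M),
    [/\ (forall O, V O -> open O),
        \bigcup_(O in V) O = setT,
        (forall O, V O -> exists2 O', U O' & O `<=` O')
      & forall p : M, exists2 N, nbhs p N &
          finite_set [set O | V O /\ O `&` N !=set0]].

Record smooth_manifold (R : realType) (n : nat) (M : topologicalType)
    (A : atlas R n M) : Prop := SmoothManifold {
  manifold_hausdorff : hausdorff_space M;
  manifold_paracompact : paracompact M;
  dom_chart_at : forall p, dom (chart_at A p) p;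
  dom_open : forall i : chart_index A, open (dom i);
  coord_inj : forall i : chart_index A, set_inj (dom i) (coord i);
  coord_continuous : forall (i : chart_index A) p, dom i p ->
    {for p, continuous (coord i)};
  coord_open : forall (i : chart_index A) O, open O -> O `<=` dom i ->
    open (coord i @` O);
  transition_smooth : forall i j : chart_index A,
    smooth_on (coord i @` (dom i `&` dom j)) (loc i (coord j)) }.

(** ** The bundle of nonzero tangent vectors *)

Section SlitBundle.
Context {R : realType} {n : nat} {M : Type} (A : atlas R n M).

Definition slit : Type :=
  {u : M * vec A | tangent u.1 u.2 /\ u.2 <> 0}.

Definition foot (u : slit) : M := (sval u).1.
Definition fib (u : slit) : vec A := (sval u).2.

(* The charts (x, y) of the tangent bundle induced by the charts x of M. *)
Definition slit_atlas : atlas R (n + n) slit :=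
  {| chart_index := chart_index A;
     dom := fun i u => dom i (foot u);
     coord := fun i u => row_mx (coord i (foot u)) (fib u i);
     chart_at := fun u => chart_at A (foot u) |}.

(* Vector fields on the slit bundle are the X : slit -> vec slit_atlas with
   [vfield X]. *)
Definition pi_vfield (X : slit -> vec A) : Prop :=
  (forall u, tangent (foot u) (X u)) /\
  (forall i : chart_index A, smooth_in (A := slit_atlas) i (fun u => X u i)).

Definition etabar : slit -> vec A := fib.

(* The projection reads (x, y) |-> x in the induced charts, and the vertical
   lift of v is the velocity of t |-> (x, y + t v). *)
Definition dpi (xi : vec slit_atlas) : vec A := fun i => lsubmx (xi i).
Definition vlift (v : vec A) : vec slit_atlas := fun i => row_mx 0 (v i).

Definition rho (X : slit -> vec slit_atlas) : slit -> vec A :=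
  fun u => dpi (X u).
Definition gamma (X : slit -> vec A) : slit -> vec slit_atlas :=
  fun u => vlift (X u).

(** ** Linear connections on the pullback bundle *)

(* [D u xi s] is D_xi s in the fibre over u, for xi tangent to the slit bundle
   at u and s a pi-vector field. *)
Definition connection : Type :=
  forall u : slit, vec slit_atlas -> (slit -> vec A) -> vec A.

Definition cov (D : connection) (X : slit -> vec slit_atlas)
    (s : slit -> vec A) : slit -> vec A :=
  fun u => D u (X u) s.

(* In [conn_smooth] X is only defined over the chart i: this is the smoothness
   of xi |-> D_xi s as a map of vector bundles. *)
Record linear_connection (D : connection) : Prop := LinearConnection {
  conn_tangent : forall u xi s, tangent u xi -> pi_vfield s ->
    tangent (foot u) (D u xi s);
  conn_smooth : forall (i : chart_index A) X s, vfield_in (A := slit_atlas) i X ->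
    pi_vfield s -> smooth_in (A := slit_atlas) i (fun u => cov D X s u i);
  conn_linear : forall u (a : R) xi xi' s,
    tangent u xi -> tangent u xi' -> pi_vfield s ->
    D u (a *: xi + xi') s = a *: D u xi s + D u xi' s;
  conn_add : forall u xi s s',
    tangent u xi -> pi_vfield s -> pi_vfield s' ->
    D u xi (s + s') = D u xi s + D u xi s';
  conn_leibniz : forall u xi f s,
    tangent u xi -> smooth_fun slit_atlas f -> pi_vfield s ->
    D u xi (fun w => f w *: s w) = dir u xi f *: s u + f u *: D u xi s }.

Definition Kmap (D : connection) (X : slit -> vec slit_atlas)
    : slit -> vec A :=
  cov D X etabar.

Definition vertical (u : slit) (xi : vec slit_atlas) : Prop :=
  tangent u xi /\ dpi xi = 0.
Definition horizontal (D : connection) (u : slit) (xi : vec slit_atlas)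
    : Prop :=
  tangent u xi /\ D u xi etabar = 0.

Definition regular (D : connection) : Prop := forall u,
  (forall xi, tangent u xi ->
     exists v h, [/\ vertical u v, horizontal D u h & xi = v + h]) /\
  (forall xi, vertical u xi -> horizontal D u xi -> xi = 0).

(* The inverse of the restriction of rho to the horizontal bundle. *)
Definition beta (D : connection) (X : slit -> vec A)
    : slit -> vec slit_atlas :=
  fun u => xget 0 [set h | horizontal D u h /\ dpi h = X u].

Definition torsion (D : connection) (X Y : slit -> vec slit_atlas)
    : slit -> vec A :=
  cov D X (rho Y) - cov D Y (rho X) - rho (bracket X Y).

Definition Qtor (D : connection) (X Y : slit -> vec A) : slit -> vec A :=
  torsion D (beta D X) (beta D Y).
Definition Ttor (D : connection) (X Y : slit -> vec A) : slit -> vec A :=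
  torsion D (gamma X) (beta D Y).

Definition curvature (D : connection) (X Y : slit -> vec slit_atlas)
    (Z : slit -> vec A) : slit -> vec A :=
  - cov D X (cov D Y Z) + cov D Y (cov D X Z) + cov D (bracket X Y) Z.

Definition Pcurv (D : connection) (X Y Z : slit -> vec A) : slit -> vec A :=
  curvature D (beta D X) (gamma Y) Z.
Definition Phat (D : connection) (X Y : slit -> vec A) : slit -> vec A :=
  Pcurv D X Y etabar.

(** ** Finsler geometry *)

(* g_ij v^i w^j with g_ij = (1/2) d^2 L^2 / dy^i dy^j. *)
Definition fmetric (L : slit -> R) (u : slit) (v w : vec A) : R :=
  let i := chart_at A (foot u) in
  2^-1 * 'd (fun z => 'd (loc (A := slit_atlas) i
                            ((fun t => L t ^+ 2) : slit -> R^o))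
                         z (row_mx 0 (w i)) : R^o)
            (coord (a := slit_atlas) i u) (row_mx 0 (v i)).

(* L is only considered on nonzero vectors; by homogeneity it extends by 0 to
   the zero section. *)
Record finsler (L : slit -> R) : Prop := Finsler {
  finsler_smooth : smooth_fun slit_atlas L;
  finsler_gt0 : forall u, 0 < L u;
  finsler_homogeneous : forall (t : R) u w, 0 < t ->
    foot w = foot u -> fib w = t *: fib u -> L w = t * L u;
  finsler_posdef : forall u v, tangent (foot u) v -> v <> 0 ->
    0 < fmetric L u v v }.

Definition gdot (L : slit -> R) (X Y : slit -> vec A) : slit -> R :=
  fun u => fmetric L u (X u) (Y u).

Record cartan_connection (L : slit -> R) (D : connection) : Prop :=
  CartanConnection {
  cartan_linear : linear_connection D;
  cartan_regular : regular D;
  cartan_metric : forall X Y Z, vfield X -> pi_vfield Y -> pi_vfield Z ->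
    forall u, dir u (X u) (gdot L Y Z)
              = gdot L (cov D X Y) Z u + gdot L Y (cov D X Z) u;
  cartan_Q : forall X Y, pi_vfield X -> pi_vfield Y -> Qtor D X Y = 0;
  cartan_T : forall X Y Z, pi_vfield X -> pi_vfield Y -> pi_vfield Z ->
    gdot L (Ttor D X Y) Z = gdot L (Ttor D X Z) Y }.

(* The Berwald connection of the Finsler manifold whose Cartan connection is
   D. *)
Definition berwald (D : connection) (X : slit -> vec slit_atlas)
    (Y : slit -> vec A) : slit -> vec A :=
  cov D X Y + Phat D (rho X) Y - Ttor D (Kmap D X) Y.

(* Concurrence is meant with D the Cartan connection of the Finsler manifold. *)
Record concurrent (D : connection) (zeta : slit -> vec A) : Prop :=
  Concurrent {
  concurrent_pi_vfield : pi_vfield zeta;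
  concurrent_h : forall X, pi_vfield X -> cov D (beta D X) zeta = - X;
  concurrent_v : forall X, pi_vfield X -> cov D (gamma X) zeta = 0 }.

End SlitBundle.

Arguments etabar {R n M} A u.

(* Main.v *)
Require Import Defs.
From HB Require Import structures.
From mathcomp Require Import all_boot all_order all_algebra.
From mathcomp Require Import all_classical all_reals all_analysis.
From mathcomp Require Import ring lra.
Import Order.TTheory GRing.Theory Num.Theory.
Import numFieldNormedType.Exports.
Local Open Scope classical_set_scope.
Local Open Scope ring_scope.

Set Implicit Arguments.
Unset Strict Implicit.
Unset Printing Implicit Defensive.

(** Write E = L^2 / 2, theta = g(zeta, .), p^2 = theta(zeta), K for the
    connection map of the Cartan connection D of L, and g', K', D' for the
    objects of the changed metric. The flat connection of the fibres gives a
    vertical derivative [vd X Y] of a pi-vector field, and [vdf X f] of a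
    function, along the vertical lift of X.

    Vertical Hessian. The metric is g(Y, Z) = Y Z E - (vd Y Z) E ([gdotE]), and
    Euler's relation gives g(Z, eta) = Z E ([gdot_eta]). So the vertical
    derivative [vdg] of g is totally symmetric and vanishes on eta.

    Only K matters. Metricity and the symmetry of T give D_(gamma X) eta = X
    ([K_gamma]), so each W is beta (rho W) + gamma (K W), and the Berwald
    connection becomes vd (K W) Y + K [beta (rho W), gamma Y] ([berwaldE]).

    Concurrence. D_W zeta = - rho W for all W, so W (p^2) = - 2 theta (rho W).
    Applied to W = [gamma X, beta Y] this gives theta (T(X, Y)) = 0, hence
    zeta and p^2 are constant along the fibres ([vd_zeta], [vdf_p2]), and
    g' = g + theta theta ([gdot_change]).

    The change of K. The tensor A := K' o beta, called [dK], determines K' and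
    beta'. Its part antisymmetric for g' is read off from the vanishing torsion
    of D' on horizontal lifts, its symmetric part from the derivative of g'
    along beta' eta; D computes the rest, and the result is
    A X = - g(X, eta) / (1 + p^2) zeta ([dKE]).

    Conclusion. By [berwaldE] the two Berwald connections differ by the vertical
    derivative of the tensor A, which is - g(X, Y) / (1 + p^2) zeta ([vd_dK]).

    All identities are between globally defined fields. An equation g(V, Z) = 0
    is only ever tested on Z = V, so that positivity of g replaces the
    extension of tangent vectors to fields. *)

(** * Symmetry of second derivatives *)

Section Calculus.
Context {R : realType}.

Lemma is_diff_near_0 (V W : normedModType R) (h : V -> W) (x : V) :
  (\near x, h x = 0) -> is_diff x h 0.
Proof.
move=> h0.
have hx : h x = 0 by exact: nbhs_singleton h0.
have h0' : \forall y \near (0 : V), h (y + x) = 0.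
  by move: h0; rewrite (near_shift 0) subr0.
have hE : h \o shift x = cst (h x) + \0 +o_ (0 : V) id.
  rewrite hx; apply/eqaddoP => _/posnumP[e]; near=> y.
  rewrite /= !fctE !addr0 /=.
  have -> : h (y + x) = 0 by near: y; exact: h0'.
  by rewrite subr0 normr0 mulr_ge0.
have c0 : continuous (\0 : V -> W) by move=> ?; exact: cvg_cst.
have hd : 'd h x = \0 :> (V -> W) by exact: (@diff_unique _ V W h \0 x).
by apply: DiffDef; rewrite ?hd//; apply/diff_locallyP; rewrite hd.
Unshelve. all: by end_near. Qed.

Lemma near_eq_is_diff (V W : normedModType R) (f g df : V -> W) (x : V) :
  (\near x, f x = g x) -> is_diff x f df -> is_diff x g df.
Proof.
move=> fg fd.
have gf : is_diff x (g - f) 0.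
  apply: is_diff_near_0; apply: filterS fg => z /= fz.
  by rewrite !fctE fz subrr.
have := is_diffD fd gf; rewrite addr0.
by have -> : f + (g - f) = g by rewrite addrC subrK.
Qed.

Lemma is_diffE (V W : normedModType R) (f df : V -> W) (x : V) :
  is_diff x f df -> 'd f x = df :> (V -> W).
Proof. by move=> fd; exact: diff_val. Qed.

Lemma differentiable_is_diff (V W : normedModType R) (f df : V -> W) (x : V) :
  is_diff x f df -> differentiable f x.
Proof. by case. Qed.

Lemma open_near_eq (V W : normedModType R) (O : set V) (f g : V -> W) (x : V) :
  open O -> O x -> {in O, f =1 g} -> \near x, f x = g x.
Proof.
move=> oO Ox fg; have := open_nbhs_nbhs (conj oO Ox).
by apply: filterS => z Oz; apply: fg; rewrite inE.
Qed.

Lemma scale_is_bilinear (W : normedModType R) :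
  bilinear_for
    (GRing.Scale.Law.clone _ _ *:%R _) (GRing.Scale.Law.clone _ _ *:%R _)
    (fun (a : R^o) (w : W) => a *: w).
Proof.
split=> [u'|u] a x y /=.
- by rewrite scalerDl scalerA.
- by rewrite scalerDr !scalerA mulrC.
Qed.

Lemma is_diff_scale (V W : normedModType R) (f df : V -> R^o) (g dg : V -> W) x :
  is_diff x f df -> is_diff x g dg ->
  is_diff x (fun z => f z *: g z) (fun v => f x *: dg v + df v *: g x).
Proof.
move=> fd gd.
pose b : R^o -> W -> W := fun a w => a *: w.
pose bM := bilinear_isBilinear.Build R R^o W W _ _ b (@scale_is_bilinear W).
pose bL : {bilinear R^o -> W -> W} := HB.pack b bM.
have bc : continuous (fun p => bL p.1 p.2) by exact: scale_continuous.
have bd p : is_diff p (fun q => bL q.1 q.2) (fun q => bL p.1 q.2 + bL q.1 p.2).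
  by apply: DiffDef; [exact: differentiable_bilin|rewrite diff_bilin].
have -> : (fun z => f z *: g z) = (fun p => bL p.1 p.2) \o (fun y => (f y, g y)).
  by [].
exact: is_diff_eq.
Qed.

Lemma is_diff_lin (V W : normedModType R) (l : {linear V -> W}) x :
  continuous l -> is_diff x l l.
Proof.
by move=> lc; apply: DiffDef; [exact: linear_differentiable|rewrite diff_lin].
Qed.

Lemma is_derive_line (V W : normedModType R) (f : V -> W) (v y : V) (s : R) :
  differentiable f (s *: v + y) ->
  is_derive s 1 (fun t : R => f (t *: v + y)) ('d f (s *: v + y) v).
Proof.
move=> fd.
have ld : is_diff (s : R) (fun t : R => t *: v + y) ( *:%R ^~ v).
  by have := is_diffD (is_diff_scalel s v) (is_diff_cst y (s : R)); rewrite addr0.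
have fld : differentiable (fun t : R => f (t *: v + y)) s.
  by apply: (@differentiable_comp _ _ _ _ (fun t : R => t *: v + y)).
apply: DeriveDef; first exact: diff_derivable.
rewrite deriveE // (@diff_comp _ _ _ _ (fun t : R => t *: v + y)) //=.
by rewrite diff_val scale1r.
Qed.

(** The mean value theorem, first along v and then along w. The left-hand side
    is symmetric in v and w. *)
Lemma second_difference (V : normedModType R) (O : set V) (f : V -> R^o)
    (x v w : V) (h : R) : 0 < h ->
  (forall s t, 0 <= s <= h -> 0 <= t <= h -> O (s *: v + (t *: w + x))) ->
  Ck 2 O f ->
  exists s t, [/\ 0 <= s <= h, 0 <= t <= h &
    f (h *: v + (h *: w + x)) - f (h *: v + x) - f (h *: w + x) + f x
      = h * (h * 'd (fun z => 'd f z v) (s *: v + (t *: w + x)) w)].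
Proof.
move=> h0 hO [fd fdd].
have Oh s : 0 <= s <= h -> O (s *: v + (h *: w + x)).
  by move=> sh; apply: hO => //; rewrite ltW/=.
have O0 s : 0 <= s <= h -> O (s *: v + x).
  move=> sh; have := hO s 0 sh; rewrite scale0r add0r; apply.
  by rewrite lexx ltW.
pose phi s := f (s *: v + (h *: w + x)) - f (s *: v + x).
have phid s : 0 <= s <= h -> is_derive s 1 phi
    ('d f (s *: v + (h *: w + x)) v - 'd f (s *: v + x) v).
  move=> sh; apply: is_deriveB; apply: is_derive_line; apply: fd.
    exact: Oh.
  exact: O0.
have [s] : exists2 s, s \in `]0, h[%R &
    phi h - phi 0 = ('d f (s *: v + (h *: w + x)) v - 'd f (s *: v + x) v) * (h - 0).
  apply: (@MVT R phi _ 0 h h0) => [s|].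
    rewrite in_itv/= => /andP[s0 sh]; apply: phid; by rewrite !ltW.
  apply: derivable_within_continuous => s; rewrite in_itv/= => sh.
  by have ? := phid s sh; exact: ex_derive.
rewrite in_itv/= => /andP[s0 sh].
rewrite /phi scale0r !add0r subr0 => phiE.
have sh' : 0 <= s <= h by rewrite !ltW.
have Ot t : 0 <= t <= h -> O (t *: w + (s *: v + x)).
  by move=> th; rewrite addrCA; exact: hO.
pose psi t := 'd f (t *: w + (s *: v + x)) v.
have psid t : 0 <= t <= h -> is_derive t 1 psi
    ('d (fun z => 'd f z v) (t *: w + (s *: v + x)) w).
  move=> th.
  by apply: (@is_derive_line _ _ (fun z => 'd f z v)); exact/(fdd v).1/Ot.
have [t] : exists2 t, t \in `]0, h[%R &
    psi h - psi 0 = ('d (fun z => 'd f z v) (t *: w + (s *: v + x)) w) * (h - 0).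
  apply: (@MVT R psi _ 0 h h0) => [t|].
    rewrite in_itv/= => /andP[t0 th]; apply: psid; by rewrite !ltW.
  apply: derivable_within_continuous => t; rewrite in_itv/= => th.
  by have ? := psid t th; exact: ex_derive.
rewrite in_itv/= => /andP[t0 th].
rewrite /psi scale0r add0r subr0 => psiE.
have th' : 0 <= t <= h by rewrite !ltW.
exists s, t; split => //.
rewrite [s *: v + _]addrCA [h * ('d _ _ _)]mulrC -psiE [h *: w + (s *: _ + _)]addrCA mulrC -phiE.
by rewrite opprD opprK [RHS]addrA.
Qed.

(** By [second_difference] the two mixed derivatives take the same value at
    points arbitrarily close to x, and both are continuous at x. *)
Lemma schwarz (V : normedModType R) (O : set V) (f : V -> R^o) (x v w : V) :
  open O -> O x -> Ck 2 O f ->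
  'd (fun z => 'd f z v) x w = 'd (fun z => 'd f z w) x v.
Proof.
move=> oO Ox f2.
apply/eqP; rewrite -subr_eq0 -normr_le0; apply/ler_addgt0Pl => e e0.
rewrite addr0.
have cont a b : {for x, continuous (fun z => 'd (fun z => 'd f z a) z b)}.
  exact: ((f2.2 a).2 b).
have e20 : 0 < e / 2 by rewrite divr_gt0.
have : \forall z \near x, [/\ O z,
    `|'d (fun z => 'd f z v) x w - 'd (fun z => 'd f z v) z w| < e / 2 &
    `|'d (fun z => 'd f z w) x v - 'd (fun z => 'd f z w) z v| < e / 2].
  near=> z; split; near: z.
  - exact: open_nbhs_nbhs.
  - by move/cvgrPdist_lt : (cont v w); exact.
  - by move/cvgrPdist_lt : (cont w v); exact.
move=> /nbhs_ballP[r /= r0 hr].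
pose h := r / (2 * (`|v| + `|w| + 1)).
have N0 : 0 < `|v| + `|w| + 1 by rewrite ltr_wpDl// addr_ge0.
have h0 : 0 < h by rewrite divr_gt0// mulr_gt0.
have hb a b s t : `|a| + `|b| <= `|v| + `|w| -> 0 <= s <= h -> 0 <= t <= h ->
    ball x r (s *: a + (t *: b + x)).
  move=> ab /andP[s0 sh] /andP[t0 th]; rewrite -ball_normE /= distrC addrA addrK.
  apply: (@le_lt_trans _ _ (h * (`|v| + `|w|))).
    apply: le_trans (ler_normD _ _) _; rewrite !normrZ !ger0_norm//.
    apply: le_trans (_ : h * (`|a| + `|b|) <= _).
      by rewrite mulrDr lerD// ler_wpM2r.
    by rewrite ler_wpM2l // ltW.
  apply: (@lt_le_trans _ _ (h * (2 * (`|v| + `|w| + 1)))).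
    rewrite ltr_pM2l// mulr2n mulrDl mul1r ltr_pwDr //; last by rewrite lerDl.
  by rewrite /h divfK// gt_eqF// mulr_gt0.
have [s1 [t1 [hs1 ht1 E1]]] :=
  second_difference (v := v) (w := w) h0
    (fun s t hs ht => let: And3 Oz _ _ := hr _ (hb v w s t (lexx _) hs ht) in Oz) f2.
have wv : `|w| + `|v| <= `|v| + `|w| by rewrite addrC.
have [s2 [t2 [hs2 ht2 E2]]] :=
  second_difference (v := w) (w := v) h0
    (fun s t hs ht => let: And3 Oz _ _ := hr _ (hb w v s t wv hs ht) in Oz) f2.
have : 'd (fun z => 'd f z v) (s1 *: v + (t1 *: w + x)) w =
    'd (fun z => 'd f z w) (s2 *: w + (t2 *: v + x)) v.
  have hn : h != 0 by rewrite gt_eqF.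
  apply: (mulfI hn); apply: (mulfI hn); rewrite -E1 -E2.
  by rewrite [h *: w + (h *: _ + _)]addrCA; congr (_ + _); rewrite addrAC.
have [_ b1 _] := hr _ (hb v w s1 t1 (lexx _) hs1 ht1).
have [_ _ b2] := hr _ (hb w v s2 t2 wv hs2 ht2).
move=> E12; rewrite E12 in b1.
set a := 'd _ _ _ in b1 *; set b := 'd _ x v in b2 *; set c := 'd _ _ _ in b1 b2.
rewrite -(subrK c a) -addrA [e]splitr.
apply: le_trans (ler_normD _ _) _; apply: lerD; first exact: ltW.
by rewrite distrC; exact: ltW.
Unshelve. all: by end_near. Qed.

End Calculus.

(** * Functions of class C^k *)

Section CkClosure.
Context {R : realType}.

Lemma linear_mx_continuous m n (W : normedModType R)
    (l : {linear 'M[R]_(m, n) -> W}) : continuous l.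
Proof.
have -> : (l : 'M[R]_(m, n) -> W) =
    fun A => \sum_(i < m) \sum_(j < n) A i j *: l (delta_mx i j).
  apply/funext => A; rewrite {1}[A]matrix_sum_delta linear_sum.
  apply: eq_bigr => i _; rewrite linear_sum.
  by apply: eq_bigr => j _; rewrite linearZ.
apply: continuous_big => [|i _]; first exact: add_continuous.
apply: continuous_big => [|j _]; first exact: add_continuous.
move=> A; apply: (@continuous_comp _ _ _ (fun A : 'M[R]_(m, n) => A i j)
  ( *:%R^~ (l (delta_mx i j)))); first exact: coord_continuous.
exact: scalel_continuous.
Qed.

Lemma is_diff_lin_mx m n (W : normedModType R)
    (l : {linear 'M[R]_(m, n) -> W}) A : is_diff A l l.
Proof. exact/is_diff_lin/linear_mx_continuous. Qed.

Context {V W : normedModType R}.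
Implicit Types (O : set V) (f g : V -> W).

Lemma Ck_congr k O f g : open O -> {in O, f =1 g} -> Ck k O f -> Ck k O g.
Proof.
move=> oO; elim: k f g => [|k IH] f g fg /=.
  move=> fc x Ox; have fx : f x = g x by apply: fg; rewrite inE.
  rewrite /prop_for /continuous_at -fx; apply: cvg_trans (fc x Ox).
  by apply: near_eq_cvg; apply: filterS (open_near_eq oO Ox fg) => z ->.
move=> [fd fdd].
have gd x : O x -> is_diff x g ('d f x).
  move=> Ox; apply: near_eq_is_diff (open_near_eq oO Ox fg) _.
  exact/differentiableP/fd.
split=> [x Ox|v]; first by have := gd x Ox.
apply: IH (fdd v) => x; rewrite inE => Ox.
by rewrite (is_diffE (gd x Ox)).
Qed.

Lemma Ck_le k O f : Ck k.+1 O f -> Ck k O f.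
Proof.
elim: k f => [|k IH] f [fd fdd].
  by move=> x Ox; exact/differentiable_continuous/fd.
by split=> // v; exact/IH/fdd.
Qed.

Lemma Ck_cst k O (c : W) : Ck k O (cst c).
Proof.
elim: k c => [|k IH] c; first by move=> x Ox; exact: cvg_cst.
split=> [x Ox|v]; first exact: differentiable_cst.
have -> : (fun x => 'd (cst c) x v) = (cst 0 : V -> W).
  by apply/funext => x; rewrite (is_diffE (is_diff_cst c x)).
exact: IH.
Qed.

Lemma Ck_D k O f g : open O -> Ck k O f -> Ck k O g -> Ck k O (f \+ g).
Proof.
move=> oO; elim: k f g => [|k IH] f g fk gk.
  by move=> x Ox; apply: cvgD; [exact: fk|exact: gk].
have [[fd fdd] [gd gdd]] := (fk, gk).
have hd x : O x -> is_diff x (f \+ g) (('d f x : V -> W) + ('d g x : V -> W)).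
  by move=> Ox; apply: is_diffD; apply/differentiableP; [exact: fd|exact: gd].
split=> [x Ox|v]; first by have := hd x Ox.
apply: Ck_congr (IH _ _ (fdd v) (gdd v)) => // x; rewrite inE => Ox.
by rewrite (is_diffE (hd x Ox)).
Qed.

Lemma Ck_sum k O (I : Type) (r : seq I) (F : I -> V -> W) : open O ->
  (forall i, Ck k O (F i)) -> Ck k O (fun z => \sum_(i <- r) F i z).
Proof.
move=> oO Fk; elim: r => [|i r IH].
  by have -> : (fun z => \sum_(i <- [::]) F i z) = (cst 0 : V -> W);
    [apply/funext => z; rewrite big_nil|exact: Ck_cst].
have -> : (fun z => \sum_(i <- i :: r) F i z) =
    F i \+ (fun z => \sum_(i <- r) F i z).
  by apply/funext => z; rewrite big_cons.
exact: Ck_D.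
Qed.

End CkClosure.

Section CkClosure2.
Context {R : realType}.

Lemma Ck_scale (V W : normedModType R) k (O : set V) (f : V -> R^o) (g : V -> W) :
  open O -> Ck k O f -> Ck k O g -> Ck k O (fun z => f z *: g z).
Proof.
move=> oO; elim: k f g => [|k IH] f g fk gk.
  by move=> x Ox; apply: cvgZ; [exact: fk|exact: gk].
have [[fd fdd] [gd gdd]] := (fk, gk).
have hd x : O x -> is_diff x (fun z => f z *: g z)
    (fun v => f x *: 'd g x v + 'd f x v *: g x).
  by move=> Ox; apply: is_diff_scale; apply/differentiableP; [exact: fd|exact: gd].
split=> [x Ox|v]; first by have := hd x Ox.
apply: (@Ck_congr _ _ _ _ _ ((fun z => f z *: 'd g z v) \+ (fun z => 'd f z v *: g z))) => //.
  by move=> x; rewrite inE => Ox; rewrite (is_diffE (hd x Ox)).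
apply: Ck_D => //.
  exact: (IH _ _ (Ck_le fk) (gdd v)).
exact: (IH _ _ (fdd v) (Ck_le gk)).
Qed.

Lemma Ck_prod (V : normedModType R) k (O : set V) (I : Type) (r : seq I)
    (F : I -> V -> R^o) : open O ->
  (forall i, Ck k O (F i)) -> Ck k O (fun z => \prod_(i <- r) F i z : R^o).
Proof.
move=> oO Fk; elim: r => [|i r IH].
  by have -> : (fun z => \prod_(i <- [::]) F i z : R^o) = (cst 1 : V -> R^o);
    [apply/funext => z; rewrite big_nil|exact: Ck_cst].
have -> : (fun z => \prod_(i <- i :: r) F i z : R^o) =
    (fun z => F i z *: (\prod_(i <- r) F i z : R^o)).
  by apply/funext => z; rewrite big_cons.
exact: Ck_scale.
Qed.

(** By induction on k, since the derivative of 1/f is - (1/f) (1/f) df. *)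
Lemma Ck_inv (V : normedModType R) k (O : set V) (f : V -> R^o) :
  open O -> (forall x, O x -> f x != 0) -> Ck k O f ->
  Ck k O (fun z => (f z)^-1 : R^o).
Proof.
move=> oO f0; elim: k => [|k IH] fk.
  by move=> x Ox; apply: cvgV; [exact: f0|exact: fk].
have [fd fdd] := fk.
have hd x : O x -> is_diff x (fun z => (f z)^-1 : R^o) (- (f x) ^- 2 \*: 'd f x).
  move=> Ox; have fx := f0 x Ox; apply: DiffDef.
    by apply: differentiableV => //; exact: fd.
  by rewrite diffV//; exact: fd.
split=> [x Ox|v]; first by have := hd x Ox.
have Hi := IH (Ck_le fk).
apply: (@Ck_congr _ _ _ _ _ (fun z => (- 1 : R^o) *: ((f z)^-1 *: ((f z)^-1 *: 'd f z v)))) => //.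
  move=> x; rewrite inE => Ox; rewrite (is_diffE (hd x Ox)) /= scaleN1r.
  by rewrite !scalerA -invfM -expr2 scaleNr.
apply: Ck_scale => //; first exact: Ck_cst.
exact: Ck_scale oO Hi (Ck_scale oO Hi (fdd v)).
Qed.

Lemma Ck_linl (V W W' : normedModType R) k (O : set V) (f : V -> W)
    (l : {linear W -> W'}) : open O -> continuous l ->
  Ck k O f -> Ck k O (l \o f).
Proof.
move=> oO lc; elim: k f => [|k IH] f fk.
  by move=> x Ox; apply: continuous_comp; [exact: fk|exact: lc].
have [fd fdd] := fk.
have hd x : O x -> is_diff x (l \o f) (l \o 'd f x).
  move=> Ox; apply: is_diff_comp; first exact/differentiableP/fd.
  exact: is_diff_lin.
split=> [x Ox|v]; first by have := hd x Ox.
apply: Ck_congr (IH _ (fdd v)) => // x; rewrite inE => Ox.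
by rewrite (is_diffE (hd x Ox)).
Qed.

Lemma Ck_linr (U V W : normedModType R) k (O' : set U) (O : set V) (f : V -> W)
    (l : {linear U -> V}) : open O' -> continuous l ->
  (forall x, O' x -> O (l x)) -> Ck k O f -> Ck k O' (f \o l).
Proof.
move=> oO lc lO; elim: k f => [|k IH] f fk.
  by move=> x Ox; apply: continuous_comp; [exact: lc|exact/fk/lO].
have [fd fdd] := fk.
have hd x : O' x -> is_diff x (f \o l) ('d f (l x) \o l).
  move=> Ox; apply: is_diff_comp; first exact: is_diff_lin.
  exact/differentiableP/fd/lO.
split=> [x Ox|v]; first by have := hd x Ox.
apply: Ck_congr (IH _ (fdd (l v))) => // x; rewrite inE => Ox.
by rewrite (is_diffE (hd x Ox)).
Qed.

Lemma Ck_lin (V W : normedModType R) k (O : set V) (l : {linear V -> W}) :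
  open O -> continuous l -> Ck k O l.
Proof.
move=> oO lc; case: k => [|k]; first by move=> x Ox; exact: lc.
split=> [x Ox|v]; first by have := is_diff_lin x lc.
have -> : (fun x => 'd l x v) = (cst (l v) : V -> W).
  by apply/funext => x; rewrite (is_diffE (is_diff_lin x lc)).
exact: Ck_cst.
Qed.

Lemma Ck_mx (V : normedModType R) k (O : set V) m n (f : V -> 'M[R]_(m, n)) :
  open O -> (forall i j, Ck k O (fun z => f z i j : R^o)) -> Ck k O f.
Proof.
move=> oO fk.
have -> : f = (fun z => \sum_(i < m) \sum_(j < n)
    (fun z => (f z i j : R^o) *: delta_mx i j) z).
  by apply/funext => z; exact: matrix_sum_delta.
do 2!(apply: Ck_sum => // ?).
by apply: Ck_scale => //; exact: Ck_cst.
Qed.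

End CkClosure2.

(** * Differentials along moving vectors *)

Definition mx_entry (R : realType) m n (i : 'I_m) (j : 'I_n) (A : 'M[R]_(m, n)) : R^o :=
  A i j.

Lemma mx_entry_linear (R : realType) m n i j : linear (@mx_entry R m n i j).
Proof. by move=> a A B; rewrite /mx_entry !mxE. Qed.

HB.instance Definition _ (R : realType) m n i j :=
  GRing.isLinear.Build R 'M[R]_(m, n) R^o _ (@mx_entry R m n i j)
    (@mx_entry_linear R m n i j).

Lemma Ck_entry (R : realType) (V : normedModType R) m n i j k (O : set V)
    (f : V -> 'M[R]_(m, n)) :
  open O -> Ck k O f -> Ck k O (fun z => f z i j : R^o).
Proof.
by move=> oO; exact: (Ck_linl oO (@linear_mx_continuous _ _ _ _ (mx_entry i j))).
Qed.

Section Smooth.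
Context {R : realType}.

Lemma smooth_differentiable (V W : normedModType R) (O : set V) (f : V -> W) x :
  smooth_on O f -> O x -> differentiable f x.
Proof. by move=> /(_ 1%N)[fd _] /fd. Qed.

Lemma smooth_d (V W : normedModType R) (O : set V) (f : V -> W) v :
  smooth_on O f -> smooth_on O (fun z => 'd f z v).
Proof. by move=> fs k; have [_ fd] := fs k.+1; exact: fd. Qed.

Lemma smooth_is_diff_d (V W : normedModType R) (O : set V) (f : V -> W) x :
  smooth_on O f -> O x -> is_diff x f ('d f x).
Proof. by move=> fs Ox; exact/differentiableP/(smooth_differentiable fs). Qed.

Lemma smooth_congr (V W : normedModType R) (O : set V) (f g : V -> W) :
  open O -> (forall x, O x -> f x = g x) -> smooth_on O f -> smooth_on O g.
Proof.
by move=> oO fg fs k; apply: Ck_congr (fs k) => // x; rewrite inE; exact: fg.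
Qed.

Lemma is_diff_sum (V W : normedModType R) (I : Type) (s : seq I)
    (F dF : I -> V -> W) x :
  (forall k, is_diff x (F k) (dF k)) ->
  is_diff x (fun z => \sum_(k <- s) F k z) (fun v => \sum_(k <- s) dF k v).
Proof.
move=> Fd; elim: s => [|k s IH].
  have zE (G : I -> V -> W) : (fun z => \sum_(k <- [::]) G k z) = cst 0.
    by apply/funext => z; rewrite big_nil.
  by rewrite !zE; exact: is_diff_cst.
have cE (G : I -> V -> W) : (fun z => \sum_(i <- k :: s) G i z) =
    G k + (fun z => \sum_(i <- s) G i z).
  by apply/funext => z; rewrite big_cons.
by rewrite !cE; exact: is_diffD.
Qed.

Section DifferentiateApplied.
Context {m : nat} {W : normedModType R}.
Implicit Types (F : 'rV[R]_m -> W) (Y : 'rV[R]_m -> 'rV[R]_m) (O : set 'rV[R]_m).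

Lemma dE F z (w : 'rV[R]_m) : 'd F z w = \sum_k w 0 k *: 'd F z 'e_k.
Proof.
by rewrite {1}[w]row_sum_delta linear_sum; apply: eq_bigr => k _; rewrite linearZ.
Qed.

(** The product rule, obtained by expanding Y in the canonical basis. *)
Lemma is_diff_dapp F Y dY x :
  (forall v, differentiable (fun z => 'd F z v) x) -> is_diff x Y dY ->
  is_diff x (fun z => 'd F z (Y z))
    (fun v => 'd (fun z => 'd F z (Y x)) x v + 'd F x (dY v)).
Proof.
move=> Fd Yd.
have coordd k : is_diff x (fun z => Y z 0 k : R^o) (fun v => dY v 0 k : R^o).
  have cd := is_diff_lin_mx (mx_entry 0 k) (Y x).
  by have := is_diff_comp Yd cd.
have termd k : is_diff x (fun z => (Y z 0 k : R^o) *: 'd F z 'e_k)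
    (fun v => Y x 0 k *: 'd (fun z => 'd F z 'e_k) x v + dY v 0 k *: 'd F x 'e_k).
  exact/is_diff_scale/differentiableP.
have sumd := is_diff_sum (index_enum _) termd.
have zE : (fun z => \sum_k (Y z 0 k : R^o) *: 'd F z 'e_k) = (fun z => 'd F z (Y z)).
  by apply/funext => z; rewrite [RHS]dE.
rewrite zE in sumd.
have sumc : is_diff x (fun z => \sum_k Y x 0 k *: 'd F z 'e_k)
    (fun v => \sum_k Y x 0 k *: 'd (fun z => 'd F z 'e_k) x v).
  by apply: is_diff_sum => k; apply: is_diffZ; exact/differentiableP.
have cE : (fun z => \sum_k Y x 0 k *: 'd F z 'e_k) = (fun z => 'd F z (Y x)).
  by apply/funext => z; rewrite [RHS]dE.
rewrite cE in sumc; have {}sumc := is_diffE sumc.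
apply: is_diff_eq sumd _; apply/funext => v; rewrite big_split.
exact: congr2 (esym (congr1 (@^~ v) sumc)) (esym (dE F x (dY v))).
Qed.

Lemma smooth_dapp O F Y : open O -> smooth_on O F -> smooth_on O Y ->
  smooth_on O (fun z => 'd F z (Y z)).
Proof.
move=> oO Fs Ys k.
apply: (@Ck_congr _ _ _ _ _ (fun z => \sum_k (Y z 0 k : R^o) *: 'd F z 'e_k)) => //.
  by move=> z _; rewrite [RHS]dE.
apply: Ck_sum => // i; apply: Ck_scale => //; last exact: (smooth_d 'e_i Fs k).
exact: Ck_entry.
Qed.

End DifferentiateApplied.

Lemma schwarz_rV (V : normedModType R) m n (O : set V) (F : V -> 'M[R]_(m, n)) x v w :
  open O -> O x -> smooth_on O F ->
  'd (fun z => 'd F z v) x w = 'd (fun z => 'd F z w) x v.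
Proof.
move=> oO Ox Fs; apply/matrixP => i j.
pose cL : {linear 'M[R]_(m, n) -> R^o} := mx_entry i j.
have cc : continuous cL by exact: linear_mx_continuous.
have comp (f : V -> 'M[R]_(m, n)) z a : differentiable f z ->
    ('d f z a) i j = 'd (cL \o f) z a.
  by move=> /differentiableP/is_diff_comp/(_ (is_diff_lin_mx cL _))/is_diffE ->.
have comp2 a b : ('d (fun z => 'd F z a) x b) i j =
    'd (fun z => 'd (cL \o F) z a) x b.
  rewrite comp; last exact: smooth_differentiable (smooth_d a Fs) Ox.
  have := smooth_is_diff_d (smooth_d a Fs) Ox.
  move=> /is_diff_comp/(_ (is_diff_lin_mx cL _)) Fd.
  have := @near_eq_is_diff _ _ _ _ (fun z => 'd (cL \o F) z a) _ x _ Fd.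
  move=> /(_ _)/is_diffE ->; first by rewrite (is_diffE Fd).
  apply: (open_near_eq oO Ox) => z; rewrite inE => Oz /=.
  by rewrite -comp//; exact: smooth_differentiable Oz.
rewrite !comp2; apply: (@schwarz _ _ O) => //.
exact: Ck_linl (Fs 2%N).
Qed.

End Smooth.

Fact Dv_key : unit. Proof. exact: tt. Qed.

(** Locked, so that two derivatives are compared through their arguments and not
    by unfolding the choice of a linear map that defines the differential. *)
Definition Dv (R : realType) (V W : normedModType R) : (V -> W) -> V -> V -> W :=
  locked_with Dv_key (fun f x v => 'd f x v).

Section DirectionalDerivative.
Context {R : realType}.

Lemma DvE (V W : normedModType R) (f : V -> W) x v : Dv f x v = 'd f x v.
Proof. by rewrite /Dv unlock. Qed.

Lemma is_diff_Dv (V W : normedModType R) (f df : V -> W) (x v : V) :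
  is_diff x f df -> Dv f x v = df v.
Proof. by move=> fd; rewrite DvE (is_diffE fd). Qed.

Lemma Dv0 (V W : normedModType R) (f : V -> W) (x : V) : Dv f x 0 = 0.
Proof. by rewrite DvE linear0. Qed.

Lemma DvB (V W : normedModType R) (f : V -> W) (x v w : V) :
  Dv f x (v - w) = Dv f x v - Dv f x w.
Proof. by rewrite !DvE linearB. Qed.

Lemma DvD (V W : normedModType R) (f : V -> W) (x v w : V) :
  Dv f x (v + w) = Dv f x v + Dv f x w.
Proof. by rewrite !DvE linearD. Qed.

Lemma DvZ (V W : normedModType R) (f : V -> W) (x : V) a v :
  Dv f x (a *: v) = a *: Dv f x v.
Proof. by rewrite !DvE linearZ. Qed.

Lemma smooth_Dv (V W : normedModType R) (O : set V) (f : V -> W) v :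
  smooth_on O f -> smooth_on O (fun z => Dv f z v).
Proof.
move=> /(smooth_d v); rewrite (_ : (fun z => 'd f z v) = (fun z => Dv f z v))//.
by apply/funext => z; rewrite DvE.
Qed.

Lemma smooth_is_diff (V W : normedModType R) (O : set V) (f : V -> W) x :
  smooth_on O f -> O x -> is_diff x f (Dv f x).
Proof.
move=> fs Ox; have := smooth_is_diff_d fs Ox.
rewrite (_ : ('d f x : V -> W) = Dv f x)//.
by apply/funext => z; rewrite DvE.
Qed.

Lemma is_diff_Dv_app m (W : normedModType R) O (F : 'rV[R]_m -> W) (Y dY : 'rV_m -> 'rV_m) x :
  smooth_on O F -> O x -> is_diff x Y dY ->
  is_diff x (fun z => Dv F z (Y z))
    (fun v => Dv (fun z => Dv F z (Y x)) x v + Dv F x (dY v)).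
Proof.
move=> Fs Ox Yd.
have := is_diff_dapp (fun v => differentiable_is_diff (smooth_is_diff_d (smooth_d v Fs) Ox)) Yd.
have E : @Dv R 'rV_m W = (fun f x v => 'd f x v) by rewrite /Dv unlock.
by rewrite E.
Qed.

Lemma smooth_Dv_app m (W : normedModType R) O (F : 'rV[R]_m -> W) (Y : 'rV_m -> 'rV_m) :
  open O -> smooth_on O F -> smooth_on O Y -> smooth_on O (fun z => Dv F z (Y z)).
Proof.
move=> oO Fs Ys; have := smooth_dapp oO Fs Ys.
have E : @Dv R 'rV_m W = (fun f x v => 'd f x v) by rewrite /Dv unlock.
by rewrite E.
Qed.

Lemma Dv_sym_rV (V : normedModType R) m n (O : set V) (F : V -> 'M[R]_(m, n)) x v w :
  open O -> smooth_on O F -> O x ->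
  Dv (fun z => Dv F z v) x w = Dv (fun z => Dv F z w) x v.
Proof.
move=> oO Fs Ox; have E : @Dv R V 'M[R]_(m, n) = (fun f x v => 'd f x v).
  by rewrite /Dv unlock.
by rewrite E; exact: schwarz_rV Fs.
Qed.

Lemma Dv_sym (V : normedModType R) (O : set V) (F : V -> R^o) x v w :
  open O -> smooth_on O F -> O x ->
  Dv (fun z => Dv F z v) x w = Dv (fun z => Dv F z w) x v.
Proof.
move=> oO Fs Ox; have E : @Dv R V R^o = (fun f x v => 'd f x v).
  by rewrite /Dv unlock.
by rewrite E; exact: schwarz oO Ox (Fs 2%N).
Qed.

End DirectionalDerivative.

(** * Vector fields on a smooth atlas *)

Local Notation coord := Defs.coord.

(** A smooth structure described by the chart images alone. No topology on T is
    involved, so that the slit bundle is an instance. *)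
Record smooth_atlas (R : realType) (m : nat) (T : Type) (B : atlas R m T) : Prop :=
  SmoothAtlas {
  sa_chart : forall p, dom (chart_at B p) p;
  sa_inj : forall i : chart_index B, set_inj (dom i) (coord i);
  sa_open : forall i j : chart_index B, open (coord i @` (dom i `&` dom j));
  sa_trans : forall i j : chart_index B,
    smooth_on (coord i @` (dom i `&` dom j)) (loc i (coord j)) }.

Arguments sa_chart {R m T B}.
Arguments sa_inj {R m T B}.
Arguments sa_open {R m T B}.
Arguments sa_trans {R m T B}.

Lemma loc_inj (R : realType) m T (B : atlas R m T) (i : chart_index B)
    (V : normedModType R) (F : T -> V) p :
  set_inj (dom i) (coord i) -> dom i p -> loc i F (coord i p) = F p.
Proof.
move=> ci ip; rewrite /loc; case: xgetP => [y _ [q [iq qp] <-]|].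
  by congr F; apply: ci qp; rewrite inE.
by move=> /(_ (F p))/=; case; exists p.
Qed.

Section Atlas.
Context {R : realType} {m : nat} {T : Type} (B : atlas R m T).
Hypothesis hB : smooth_atlas B.
Implicit Types (i j : chart_index B) (p q : T) (X Y : T -> vec B).

Lemma locE i (V : normedModType R) (F : T -> V) p :
  dom i p -> loc i F (coord i p) = F p.
Proof. exact/loc_inj/sa_inj. Qed.

Lemma img_open i : open (coord i @` dom i).
Proof. by have := sa_open hB i i; rewrite setIid. Qed.

Arguments img_open : clear implicits.

Lemma chart_near i j p (P : set 'rV[R]_m) : dom i p -> dom j p ->
  (forall q, dom i q -> dom j q -> P (coord i q)) ->
  \forall z \near coord i p, P z.
Proof.
move=> ip jp hP.
have := open_nbhs_nbhs (conj (sa_open hB i j) (imageP (coord i) (conj ip jp))).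
by apply: filterS => _ [q [iq jq] <-]; exact: hP.
Qed.

Lemma is_diff_loc i p (V : normedModType R) (F : T -> V) h dh : dom i p ->
  (forall q, dom i q -> h (coord i q) = F q) ->
  is_diff (coord i p) h dh -> is_diff (coord i p) (loc i F) dh.
Proof.
move=> ip hF; apply: near_eq_is_diff.
by apply: (@chart_near i i p) => // q iq _; rewrite locE// hF.
Qed.

Lemma smooth_loc i (V : normedModType R) (F : T -> V) h :
  (forall q, dom i q -> h (coord i q) = F q) ->
  smooth_on (coord i @` dom i) h -> smooth_in i F.
Proof.
move=> hF; apply: smooth_congr; first exact: img_open.
by move=> _ [q iq <-]; rewrite locE// hF.
Qed.

Lemma is_diff_smooth_in i p (V : normedModType R) (F : T -> V) : dom i p ->
  smooth_in i F -> is_diff (coord i p) (loc i F) (Dv (loc i F) (coord i p)).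
Proof. by move=> ip Fs; apply: (smooth_is_diff Fs); exists p. Qed.

Lemma is_diff_chart i j p (V : normedModType R) (F : T -> V) dF :
  dom i p -> dom j p -> is_diff (coord j p) (loc j F) dF ->
  is_diff (coord i p) (loc i F) (dF \o Dv (loc i (coord j)) (coord i p)).
Proof.
move=> ip jp Fd.
have Pd : is_diff (coord i p) (loc i (coord j)) (Dv (loc i (coord j)) (coord i p)).
  by apply: (smooth_is_diff (sa_trans hB i j)); exists p.
have Fd' : is_diff (loc i (coord j) (coord i p)) (loc j F) dF by rewrite locE.
have := is_diff_comp Pd Fd'; apply: near_eq_is_diff.
by apply: (@chart_near i j p) => // q iq jq /=; rewrite !locE.
Qed.

Lemma tangent_trans p (v : vec B) i j : tangent p v -> dom i p -> dom j p ->
  v j = Dv (loc i (coord j)) (coord i p) (v i).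
Proof. by move=> vt ip jp; rewrite DvE; exact: vt.2. Qed.

Lemma tangent_intro p (v : vec B) : (forall i, ~ dom i p -> v i = 0) ->
  (forall i j, dom i p -> dom j p ->
    v j = Dv (loc i (coord j)) (coord i p) (v i)) -> tangent p v.
Proof. by move=> v0 vt; split=> // i j ip jp; rewrite (vt i j)// DvE. Qed.

Lemma tangent0 p : tangent p (0 : vec B).
Proof. by split=> // i j ip jp; rewrite linear0. Qed.

Lemma tangentP p (a : R) (v w : vec B) :
  tangent p v -> tangent p w -> tangent p (a *: v + w).
Proof.
move=> [v0 vt] [w0 wt]; split=> [i ip|i j ip jp].
  by rewrite !fctE /= v0// w0// scaler0 addr0.
by rewrite !fctE /= (vt _ _ ip jp) (wt _ _ ip jp) linearP.
Qed.

Lemma tangentD p (v w : vec B) : tangent p v -> tangent p w -> tangent p (v + w).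
Proof. by move=> hv hw; rewrite -[v]scale1r; exact: tangentP. Qed.

Lemma tangentZ p (a : R) (v : vec B) : tangent p v -> tangent p (a *: v).
Proof. by move=> hv; rewrite -[_ *: _]addr0; apply: tangentP => //; exact: tangent0. Qed.

Lemma tangentN p (v : vec B) : tangent p v -> tangent p (- v).
Proof. by rewrite -scaleN1r; exact: tangentZ. Qed.

Lemma tangentB p (v w : vec B) : tangent p v -> tangent p w -> tangent p (v - w).
Proof. by move=> hv hw; apply: tangentD => //; exact: tangentN. Qed.

Lemma tangent_inj i p (v w : vec B) :
  dom i p -> tangent p v -> tangent p w -> v i = w i -> v = w.
Proof.
move=> ip [v0 vt] [w0 wt] vw; apply/funext => j.
have [jp|jp] := pselect (dom j p); last by rewrite v0// w0.
by rewrite (vt _ _ ip jp) (wt _ _ ip jp) vw.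
Qed.

(** The components in the other charts are dictated by the transition maps,
    which are compatible by the chain rule. *)
Lemma tangent_extend i p (w : 'rV[R]_m) :
  dom i p -> exists2 v : vec B, tangent p v & v i = w.
Proof.
move=> ip.
pose v : vec B := fun j => if pselect (dom j p) is left _
  then Dv (loc i (coord j)) (coord i p) w else 0.
have vE j : dom j p -> v j = Dv (loc i (coord j)) (coord i p) w.
  by rewrite /v; case: pselect.
exists v.
  apply: tangent_intro => [j jp|j k jp kp]; first by rewrite /v; case: pselect.
  rewrite (vE _ jp) (vE _ kp).
  have Pd : is_diff (coord j p) (loc j (coord k)) (Dv (loc j (coord k)) (coord j p)).
    by apply: (smooth_is_diff (sa_trans hB j k)); exists p.
  exact: (is_diff_Dv w (is_diff_chart ip jp Pd)).
rewrite (vE _ ip).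
have : is_diff (coord i p) (loc i (coord i)) id by exact: is_diff_loc (is_diff_id _).
exact: is_diff_Dv.
Qed.

Lemma vfield_tangent X p : vfield X -> tangent p (X p : vec B).
Proof. by move=> /(_ (chart_at B p))[+ _]; apply; exact: (sa_chart hB). Qed.

Lemma is_diff_vfield i p X : dom i p -> vfield X ->
  is_diff (coord i p) (loc i (fun q => X q i : 'rV_m))
    (Dv (loc i (fun q => X q i)) (coord i p)).
Proof. by move=> ip /(_ i)[_]; exact: is_diff_smooth_in. Qed.

Lemma vfield_intro X : (forall p, tangent p (X p : vec B)) ->
  (forall i, smooth_in i (fun p => X p i)) -> vfield X.
Proof. by move=> Xt Xs i; split. Qed.

Lemma smooth_in_cst i (V : normedModType R) (c : V) : smooth_in i (fun=> c).
Proof. by apply: (@smooth_loc _ _ _ (cst c)) => // k; exact: Ck_cst. Qed.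

Lemma smooth_inD i (V : normedModType R) (F G : T -> V) :
  smooth_in i F -> smooth_in i G -> smooth_in i (fun p => F p + G p).
Proof.
move=> Fs Gs; apply: (@smooth_loc _ _ _ (loc i F \+ loc i G)).
  by move=> q iq /=; rewrite !locE.
by move=> k; apply: Ck_D; [exact: img_open|exact: Fs|exact: Gs].
Qed.

Lemma smooth_in_scale i (V : normedModType R) (f : T -> R^o) (G : T -> V) :
  smooth_in i f -> smooth_in i G -> smooth_in i (fun p => f p *: G p).
Proof.
move=> Fs Gs; apply: (@smooth_loc _ _ _ (fun z => loc i f z *: loc i G z)).
  by move=> q iq /=; rewrite !locE.
by move=> k; apply: Ck_scale; [exact: img_open|exact: Fs|exact: Gs].
Qed.

Lemma smooth_inN i (V : normedModType R) (F : T -> V) :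
  smooth_in i F -> smooth_in i (fun p => - F p).
Proof.
move=> Fs; rewrite (_ : (fun _ => _) = (fun p => (-1 : R^o) *: F p)).
  exact/smooth_in_scale/Fs/smooth_in_cst.
by apply/funext => p; rewrite scaleN1r.
Qed.

Lemma smooth_inB i (V : normedModType R) (F G : T -> V) :
  smooth_in i F -> smooth_in i G -> smooth_in i (fun p => F p - G p).
Proof. by move=> Fs Gs; apply: smooth_inD => //; exact: smooth_inN. Qed.

Lemma smooth_in_inv i (f : T -> R^o) : (forall p, f p != 0) ->
  smooth_in i f -> smooth_in i (fun p => (f p)^-1 : R^o).
Proof.
move=> f0 fs; apply: (@smooth_loc _ _ _ (fun z => (loc i f z)^-1)).
  by move=> q iq; rewrite locE.
move=> k; apply: Ck_inv; first exact: img_open; last exact: fs.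
by move=> _ [q iq <-]; rewrite locE.
Qed.

Lemma smooth_in_Dv i (V : normedModType R) (F : T -> V) (Y : T -> 'rV[R]_m) :
  smooth_in i F -> smooth_in i Y ->
  smooth_in i (fun p => Dv (loc i F) (coord i p) (Y p)).
Proof.
move=> Fs Ys; apply: (@smooth_loc _ _ _ (fun z => Dv (loc i F) z (loc i Y z))).
  by move=> q iq; rewrite locE.
by apply: smooth_Dv_app => //; exact: img_open.
Qed.

Lemma is_diff_loc_Dv i p (V : normedModType R) (F : T -> V) (Y : T -> 'rV[R]_m) :
  dom i p -> smooth_in i F -> smooth_in i Y ->
  is_diff (coord i p) (loc i (fun q => Dv (loc i F) (coord i q) (Y q)))
    (fun v => Dv (fun z => Dv (loc i F) z (Y p)) (coord i p) v +
              Dv (loc i F) (coord i p) (Dv (loc i Y) (coord i p) v)).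
Proof.
move=> ip Fs Ys.
apply: (@is_diff_loc _ _ _ _ (fun z => Dv (loc i F) z (loc i Y z))) => //.
  by move=> q iq; rewrite locE.
rewrite -[in X in _ X](locE Y ip); apply: is_diff_Dv_app Fs _ _.
  by exists p.
exact: is_diff_smooth_in.
Qed.

Lemma is_diff_locD i p (V : normedModType R) (F G : T -> V) dF dG : dom i p ->
  is_diff (coord i p) (loc i F) dF -> is_diff (coord i p) (loc i G) dG ->
  is_diff (coord i p) (loc i (fun q => F q + G q)) (fun v => dF v + dG v).
Proof.
move=> ip Fd Gd; apply: (@is_diff_loc _ _ _ _ (loc i F \+ loc i G)) => //.
  by move=> q iq /=; rewrite !locE.
Qed.

Lemma is_diff_loc_scale i p (V : normedModType R) (f : T -> R^o) (G : T -> V) df dG :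
  dom i p ->
  is_diff (coord i p) (loc i f) df -> is_diff (coord i p) (loc i G) dG ->
  is_diff (coord i p) (loc i (fun q => f q *: G q))
    (fun v => f p *: dG v + df v *: G p).
Proof.
move=> ip fd Gd.
apply: (@is_diff_loc _ _ _ _ (fun z => loc i f z *: loc i G z)) => //.
  by move=> q iq /=; rewrite !locE.
by rewrite -[in X in _ X](locE f ip) -[in X in _ X](locE G ip); exact: is_diff_scale.
Qed.

Lemma dir_Dv p (v : vec B) (f : T -> R) : dir p v f =
  Dv (loc (chart_at B p) (f : T -> R^o)) (coord (chart_at B p) p) (v (chart_at B p)).
Proof. by rewrite DvE. Qed.

Lemma dirE i p v (f : T -> R) : smooth_fun B f -> dom i p -> tangent p v ->
  dir p v f = Dv (loc i (f : T -> R^o)) (coord i p) (v i).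
Proof.
move=> fs ip vt; rewrite dir_Dv; have cp := sa_chart hB p.
rewrite (tangent_trans vt cp ip).
exact: (is_diff_Dv _ (is_diff_chart cp ip (is_diff_smooth_in ip (fs i)))).
Qed.

Lemma dirf_smooth X f : vfield X -> smooth_fun B f ->
  smooth_fun B (fun p => dir p (X p) f).
Proof.
move=> Xv fs i.
have : smooth_in i (fun p => Dv (loc i (f : T -> R^o)) (coord i p) (X p i) : R^o).
  by apply: smooth_in_Dv; [exact: fs|exact: (Xv i).2].
apply: smooth_congr; first exact: img_open.
move=> _ [q iq <-]; rewrite !locE// (dirE fs iq)//; exact: vfield_tangent.
Qed.

Lemma dir_lin p (a : R) (v w : vec B) f :
  dir p (a *: v + w) f = a * dir p v f + dir p w f.
Proof. by rewrite !dir_Dv /= !fctE DvD DvZ. Qed.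

Lemma dir0 p f : dir p (0 : vec B) f = 0.
Proof. by rewrite dir_Dv Dv0. Qed.

Lemma dir_add p (v : vec B) f g : smooth_fun B f -> smooth_fun B g ->
  dir p v (fun q => f q + g q) = dir p v f + dir p v g.
Proof.
move=> fs gs; rewrite !dir_Dv; have cp := sa_chart hB p.
exact: (is_diff_Dv _ (is_diff_locD cp (is_diff_smooth_in cp (fs _))
  (is_diff_smooth_in cp (gs _)))).
Qed.

Lemma dir_mul p (v : vec B) f g : smooth_fun B f -> smooth_fun B g ->
  dir p v (fun q => f q * g q) = f p * dir p v g + g p * dir p v f.
Proof.
move=> fs gs; rewrite !dir_Dv; have cp := sa_chart hB p.
apply: etrans (is_diff_Dv _ (is_diff_loc_scale cp (is_diff_smooth_in cp (fs _))
  (is_diff_smooth_in cp (gs _)))) _.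
by congr (_ + _); rewrite mulrC.
Qed.

Lemma dir_cst p (v : vec B) c : dir p v (fun=> c) = 0.
Proof.
rewrite dir_Dv; have cp := sa_chart hB p.
have cd : is_diff (coord (chart_at B p) p) (loc (chart_at B p) (fun=> c : R^o)) 0.
  by apply: (@is_diff_loc _ _ _ _ (cst c)) => //; exact: is_diff_cst.
exact: is_diff_Dv cd.
Qed.

Lemma smooth_fun_cst c : smooth_fun B (fun=> c).
Proof. by move=> i; exact: smooth_in_cst. Qed.

Lemma smooth_funD f g : smooth_fun B f -> smooth_fun B g ->
  smooth_fun B (fun p => f p + g p).
Proof. by move=> fs gs i; apply: smooth_inD; [exact: fs|exact: gs]. Qed.

Lemma smooth_funM f g : smooth_fun B f -> smooth_fun B g ->
  smooth_fun B (fun p => f p * g p).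
Proof. by move=> fs gs i; apply: smooth_in_scale; [exact: fs|exact: gs]. Qed.

Lemma smooth_funV f : (forall p, f p != 0) -> smooth_fun B f ->
  smooth_fun B (fun p => (f p)^-1).
Proof. by move=> f0 fs i; apply: smooth_in_inv. Qed.

Lemma bracketE X Y p i : bracket X Y p i =
  Dv (loc i (fun q => Y q i)) (coord i p) (X p i) -
  Dv (loc i (fun q => X q i)) (coord i p) (Y p i).
Proof. by rewrite !DvE. Qed.

Lemma bracketC X Y p : bracket X Y p = - bracket Y X p.
Proof. by apply/funext => i; rewrite !fctE /= !bracketE opprB. Qed.

Lemma bracketBl X X' Y p : vfield X -> vfield X' -> vfield Y ->
  bracket (fun q => X q - X' q : vec B) Y p = bracket X Y p - bracket X' Y p.
Proof.
move=> Xv Xv' Yv; apply/funext => i; rewrite !fctE /= !bracketE.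
have [ip|ip] := pselect (dom i p); last first.
  rewrite !fctE /= ((vfield_tangent p Xv).1 i ip) ((vfield_tangent p Xv').1 i ip).
  by rewrite ((vfield_tangent p Yv).1 i ip) subr0 !Dv0 !subr0.
have d := is_diffB (is_diff_vfield ip Xv) (is_diff_vfield ip Xv').
have h : is_diff (coord i p) (loc i (fun q => (X q - X' q : vec B) i))
   (Dv (loc i (fun q => X q i)) (coord i p) - Dv (loc i (fun q => X' q i)) (coord i p)).
  by apply: is_diff_loc d => // q iq; rewrite !fctE /= !locE.
rewrite (is_diff_Dv _ h) !fctE /= DvB !opprD !opprK.
by rewrite addrACA.
Qed.

(** Obtained by differentiating X_j = d phi (X_i). The first term, a second
    derivative of phi, is symmetric in X_i and w. *)
Lemma Dv_vfield_chart i j p X (w : 'rV[R]_m) : dom i p -> dom j p -> vfield X ->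
  Dv (loc j (fun q => X q j)) (coord j p) (Dv (loc i (coord j)) (coord i p) w) =
  Dv (fun z => Dv (loc i (coord j)) z (X p i)) (coord i p) w +
  Dv (loc i (coord j)) (coord i p) (Dv (loc i (fun q => X q i)) (coord i p) w).
Proof.
move=> ip jp Xv.
apply: etrans (esym (is_diff_Dv w (is_diff_chart ip jp (is_diff_vfield jp Xv)))) _.
have Oz : (coord i @` (dom i `&` dom j)) (coord i p) by exists p.
have := is_diff_Dv_app (sa_trans hB i j) Oz (is_diff_vfield ip Xv).
rewrite locE// => h; refine (is_diff_Dv w (near_eq_is_diff _ h)).
apply: (@chart_near i j p) => // q iq jq; rewrite !locE//.
by rewrite (tangent_trans (vfield_tangent q Xv) iq jq).
Qed.

(** The second derivatives of the transition map cancel in the bracket. *)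
Lemma bracket_vfield X Y : vfield X -> vfield Y -> vfield (bracket X Y : T -> vec B).
Proof.
move=> Xv Yv; apply: vfield_intro => [p|i]; last first.
  rewrite (_ : (fun p => bracket X Y p i) = fun p =>
      Dv (loc i (fun q => Y q i)) (coord i p) (X p i) -
      Dv (loc i (fun q => X q i)) (coord i p) (Y p i)); last first.
    by apply/funext => p; exact: bracketE.
  by apply: smooth_inB; apply: smooth_in_Dv; do ?[exact: (Xv i).2|exact: (Yv i).2].
have [Xt Yt] := (vfield_tangent p Xv, vfield_tangent p Yv).
apply: tangent_intro => [i ip|i j ip jp].
  by rewrite bracketE (Xt.1 i ip) (Yt.1 i ip) !Dv0 subr0.
rewrite !bracketE (tangent_trans Xt ip jp) (tangent_trans Yt ip jp).
rewrite (Dv_vfield_chart _ ip jp Xv) (Dv_vfield_chart _ ip jp Yv) DvB.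
have Oz : (coord i @` (dom i `&` dom j)) (coord i p) by exists p.
rewrite (Dv_sym_rV (Y p i) (X p i) (sa_open hB i j) (sa_trans hB i j) Oz).
by rewrite opprD addrACA subrr add0r.
Qed.

Lemma Dv_dir i p X f (v : 'rV[R]_m) : dom i p -> vfield X -> smooth_fun B f ->
  Dv (loc i (fun q => dir q (X q) f : R^o)) (coord i p) v =
    Dv (fun z => Dv (loc i (f : T -> R^o)) z (X p i)) (coord i p) v +
    Dv (loc i (f : T -> R^o)) (coord i p) (Dv (loc i (fun q => X q i)) (coord i p) v).
Proof.
move=> ip Xv fs; have h := is_diff_loc_Dv ip (fs i) (Xv i).2.
refine (is_diff_Dv v (near_eq_is_diff _ h)).
apply: (@chart_near i i p) => // q iq _; rewrite !locE// (dirE fs iq)//.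
exact: vfield_tangent.
Qed.

(** The second derivatives of f cancel in the difference. *)
Lemma dir_bracket X Y f p : vfield X -> vfield Y -> smooth_fun B f ->
  dir p (bracket X Y p) f =
  dir p (X p) (fun q => dir q (Y q) f) - dir p (Y p) (fun q => dir q (X q) f).
Proof.
move=> Xv Yv fs; have cp := sa_chart hB p; set c := chart_at B p in cp.
rewrite (dirE fs cp (vfield_tangent p (bracket_vfield Xv Yv))).
rewrite (dirE (dirf_smooth Yv fs) cp (vfield_tangent p Xv)).
rewrite (dirE (dirf_smooth Xv fs) cp (vfield_tangent p Yv)).
rewrite (Dv_dir _ cp Xv fs) (Dv_dir _ cp Yv fs) bracketE DvB.
have Oz : (coord c @` dom c) (coord c p) by exists p.
rewrite (Dv_sym (Y p c) (X p c) (img_open c) (fs c) Oz).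
by rewrite opprD addrACA subrr add0r.
Qed.

End Atlas.

Arguments img_open {R m T B} hB i.

(** * The slit tangent bundle *)

Section RowMx.
Context {R : realType} {n1 n2 : nat}.

Definition rowl : {linear 'rV[R]_n1 -> 'rV[R]_(n1 + n2)} := mulmxr (row_mx 1%:M 0).
Definition rowr : {linear 'rV[R]_n2 -> 'rV[R]_(n1 + n2)} := mulmxr (row_mx 0 1%:M).

Arguments rowl : simpl never.
Arguments rowr : simpl never.

Lemma rowlE v : rowl v = row_mx v 0.
Proof. by rewrite /rowl /= mul_mx_row mulmx1 mulmx0. Qed.

Lemma rowrE v : rowr v = row_mx 0 v.
Proof. by rewrite /rowr /= mul_mx_row mulmx1 mulmx0. Qed.

Lemma row_mxE v w : row_mx v w = rowl v + rowr w.
Proof. by rewrite rowlE rowrE add_row_mx addr0 add0r. Qed.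

Context {V : normedModType R}.
Implicit Types (f : V -> 'rV[R]_n1) (g : V -> 'rV[R]_n2).

Lemma is_diff_row_mx f df g dg x : is_diff x f df -> is_diff x g dg ->
  is_diff x (fun z => row_mx (f z) (g z)) (fun v => row_mx (df v) (dg v)).
Proof.
move=> fd gd.
have fd' := is_diff_comp fd (is_diff_lin_mx rowl (f x)).
have gd' := is_diff_comp gd (is_diff_lin_mx rowr (g x)).
have := is_diffD fd' gd'.
have E (a : V -> 'rV[R]_n1) (b : V -> 'rV[R]_n2) :
    (rowl \o a) + (rowr \o b) = fun z => row_mx (a z) (b z).
  by apply/funext => z; rewrite row_mxE.
by rewrite !E.
Qed.

Lemma smooth_row_mx (O : set V) f g : open O -> smooth_on O f -> smooth_on O g ->
  smooth_on O (fun z => row_mx (f z) (g z)).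
Proof.
move=> oO fs gs k.
have E : (rowl \o f) \+ (rowr \o g) = fun z => row_mx (f z) (g z).
  by apply/funext => z; rewrite row_mxE.
by rewrite -E; apply: Ck_D => //; apply: Ck_linl => //; exact: linear_mx_continuous.
Qed.

End RowMx.

Section AtlasLinear.
Context {R : realType} {m : nat} {T : Type} (B : atlas R m T).
Hypothesis hB : smooth_atlas B.
Context {n1 n2 k1 k2 : nat} (l : {linear 'M[R]_(n1, n2) -> 'M[R]_(k1, k2)}).
Implicit Types (i : chart_index B) (F : T -> 'M[R]_(n1, n2)).

Lemma smooth_in_lin i F : smooth_in i F -> smooth_in i (fun q => l (F q)).
Proof.
move=> Fs; apply: (smooth_loc hB (h := l \o loc i F)).
  by move=> q iq /=; rewrite (locE hB).
move=> k; apply: Ck_linl (Fs k); first exact: (img_open hB).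
exact: linear_mx_continuous.
Qed.

Lemma Dv_loc_lin i F p v : dom i p -> smooth_in i F ->
  Dv (loc i (fun q => l (F q))) (coord i p) v = l (Dv (loc i F) (coord i p) v).
Proof.
move=> ip Fs; have Fd := is_diff_smooth_in ip Fs.
have h := is_diff_comp Fd (is_diff_lin_mx l _).
refine (is_diff_Dv v (is_diff_loc hB ip _ h)).
by move=> q iq /=; rewrite (locE hB).
Qed.

End AtlasLinear.

Section SlitAtlas.
Context {R : realType} {n : nat} {M : Type} {A : atlas R n M}.
Hypothesis hA : smooth_atlas A.
Local Notation B := (slit_atlas A).
Implicit Types (i j : chart_index A) (u : slit A) (z : 'rV[R]_(n + n)).
Local Notation trans i j := (loc i (coord j : M -> 'rV[R]_n)).

Lemma foot_tangent u : tangent (foot u) (fib u).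
Proof. by case: u => -[p v] []. Qed.

Lemma fib_neq0 i u : dom i (foot u) -> fib u i != 0.
Proof.
move=> iu; apply/eqP => ui0; case: (svalP u) => _; apply.
exact: (tangent_inj iu (foot_tangent u) (tangent0 _ _) ui0).
Qed.

Lemma slit_imgE i j : coord (a := B) i @` (dom (a := B) i `&` dom (a := B) j) =
  [set z | (coord i @` (dom i `&` dom j)) (lsubmx z)] `&`
  [set z : 'rV[R]_(n + n) | rsubmx z != 0].
Proof.
apply/seteqP; split=> [_ [u [iu ju] <-]|z [[p [ip jp] pz] z0]] /=.
  rewrite row_mxKl row_mxKr; split; last exact: fib_neq0.
  by exists (foot u).
have [v vt vi] := tangent_extend hA (rsubmx z) ip.
have v0 : v <> 0 by move=> vE; move: z0; rewrite /= -vi vE eqxx.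
exists (exist _ (p, v) (conj vt v0)) => //.
by rewrite /= /foot /fib /= pz vi hsubmxK.
Qed.

Lemma slit_img_open i j :
  open (coord (a := B) i @` (dom (a := B) i `&` dom (a := B) j)).
Proof.
rewrite slit_imgE; apply: openI.
  apply: open_comp (sa_open hA i j) => z _.
  exact: continuous_lsubmx.
have -> : [set z : 'rV[R]_(n + n) | rsubmx z != 0] =
    rsubmx @^-1` [set y : 'rV[R]_n | 0 < `|y|].
  by apply/seteqP; split=> z /=; rewrite normr_gt0.
apply: open_comp; first by move=> z _; exact: continuous_rsubmx.
have -> : [set y : 'rV[R]_n | 0 < `|y|] = (@Num.norm R 'rV[R]_n) @^-1` [set r | 0 < r] by [].
by apply: open_comp (@open_gt _ 0) => y _; exact: norm_continuous.
Qed.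

Lemma slit_transE i j u : dom i (foot u) -> dom j (foot u) ->
  coord (a := B) j u = row_mx (trans i j (coord i (foot u)))
    (Dv (trans i j) (coord i (foot u)) (fib u i)).
Proof.
move=> iu ju /=; rewrite (locE hA)//; congr row_mx.
exact: (tangent_trans (foot_tangent u) iu ju).
Qed.

Lemma Dv_lsubmx i j z w : (coord i @` (dom i `&` dom j)) (lsubmx z) ->
  Dv (fun z => trans i j (lsubmx z)) z w = Dv (trans i j) (lsubmx z) (lsubmx w).
Proof.
move=> zO.
have ld := is_diff_lin_mx (lsubmx : {linear 'rV[R]_(n + n) -> 'rV[R]_n}) z.
exact: (is_diff_Dv w (is_diff_comp ld (smooth_is_diff (sa_trans hA i j) zO))).
Qed.

Lemma slit_img_base i j z :
  (coord (a := B) i @` (dom (a := B) i `&` dom (a := B) j)) z ->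
  (coord i @` (dom i `&` dom j)) (lsubmx z).
Proof. by rewrite slit_imgE => -[]. Qed.

Lemma trans_lsubmx_smooth i j :
  smooth_on (coord (a := B) i @` (dom (a := B) i `&` dom (a := B) j))
    (fun z => trans i j (lsubmx z)).
Proof.
move=> k; apply: (@Ck_linr _ _ _ _ k _ _ (trans i j) lsubmx _ _ (@slit_img_base i j)).
- exact: slit_img_open.
- exact: linear_mx_continuous.
- exact: sa_trans hA i j k.
Qed.

Lemma Dv_Dv_lsubmx i j z (c : 'rV[R]_n) w :
  (coord (a := B) i @` (dom (a := B) i `&` dom (a := B) j)) z ->
  Dv (fun z => Dv (fun z => trans i j (lsubmx z)) z (row_mx c 0)) z w =
  Dv (fun x => Dv (trans i j) x c) (lsubmx z) (lsubmx w).
Proof.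
move=> Oz; have ld := is_diff_lin_mx (lsubmx : {linear 'rV[R]_(n + n) -> 'rV[R]_n}) z.
have Gd := smooth_is_diff (smooth_Dv c (sa_trans hA i j)) (slit_img_base Oz).
have h := is_diff_comp ld Gd; refine (is_diff_Dv w (near_eq_is_diff _ h)).
have oO := @slit_img_open i j.
apply: (open_near_eq oO Oz) => y; rewrite inE => Oy /=.
by rewrite Dv_lsubmx ?row_mxKl//; exact: slit_img_base Oy.
Qed.

Lemma slit_inj i : set_inj (dom (a := B) i) (coord (a := B) i).
Proof.
move=> u w; rewrite !inE => iu iw /= uw.
have uw1 : foot u = foot w.
  by apply: (sa_inj hA i); rewrite ?inE//; have := congr1 lsubmx uw; rewrite !row_mxKl.
have uw2 : fib u = fib w.
  apply: (@tangent_inj _ _ _ A i (foot u)) => //; [exact: foot_tangent| |].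
    by rewrite uw1; exact: foot_tangent.
  by have := congr1 rsubmx uw; rewrite !row_mxKr.
case: u w uw1 uw2 {iu iw uw} => [[p v] pv] [[q w] qw]; rewrite /foot /fib /= => pq vw.
by case: _ / pq in qw *; case: _ / vw in qw *; congr exist; exact: Prop_irrelevance.
Qed.

(** The fibre component of the transition map is the derivative of
    (x, y) |-> phi x along (y, 0), where phi is the transition map of M. *)
Lemma slit_trans_smooth i j :
  smooth_on (coord (a := B) i @` (dom (a := B) i `&` dom (a := B) j))
    (loc (A := B) i (coord (a := B) j)).
Proof.
set O := (X in smooth_on X _).
have oO : open O by exact: slit_img_open.
pose F z := trans i j (lsubmx z).
have Fs : smooth_on O F by exact: trans_lsubmx_smooth.
pose Y : 'rV[R]_(n + n) -> 'rV[R]_(n + n) := fun z => row_mx (rsubmx z) 0.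
have Ys : smooth_on O Y.
  apply: smooth_row_mx => // k; last exact: Ck_cst.
  by apply: (@Ck_lin _ 'rV[R]_(n + n) 'rV[R]_n k O rsubmx) => //;
    exact: linear_mx_continuous.
have : smooth_on O (fun z => row_mx (F z) (Dv F z (Y z))).
  by apply: smooth_row_mx => //; exact: smooth_Dv_app.
apply: smooth_congr => // z Oz; rewrite Dv_lsubmx; last exact: slit_img_base Oz.
case: Oz => u [iu ju] <-.
rewrite (loc_inj _ (@slit_inj i))// (slit_transE iu ju).
by rewrite /F /Y /= !row_mxKl row_mxKr.
Qed.

Lemma slit_smooth_atlas : smooth_atlas B.
Proof.
split; [|exact: slit_inj|exact: slit_img_open|exact: slit_trans_smooth].
by move=> u; exact: (sa_chart hA).
Qed.

(** The differential of (x, y) |-> (phi x, d phi_x y). Its base part depends on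
    the base part of w alone, and on vertical vectors it is d phi_x: this is why
    [rho] and [gamma] respect tangency. *)
Lemma Dv_slit_trans i j u w : dom i (foot u) -> dom j (foot u) ->
  Dv (loc (A := B) i (coord (a := B) j)) (coord (a := B) i u) w =
  row_mx (Dv (trans i j) (coord i (foot u)) (lsubmx w))
    (Dv (fun x => Dv (trans i j) x (fib u i)) (coord i (foot u)) (lsubmx w) +
     Dv (trans i j) (coord i (foot u)) (rsubmx w)).
Proof.
move=> iu ju; have [z zE] : exists z, coord (a := B) i u = z by exists (coord (a := B) i u).
rewrite zE.
set O := coord (a := B) i @` (dom (a := B) i `&` dom (a := B) j).
have oO : open O by exact: slit_img_open.
have Oz : O z by exists u.
have lzE : lsubmx z = coord i (foot u) by rewrite -zE row_mxKl.
have rzE : rsubmx z = fib u i by rewrite -zE row_mxKr.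
pose F z := trans i j (lsubmx z).
have Fs : smooth_on O F by exact: trans_lsubmx_smooth.
pose Y : 'rV[R]_(n + n) -> 'rV[R]_(n + n) := fun z => row_mx (rsubmx z) 0.
have Yd : is_diff z Y Y.
  have rd := is_diff_lin_mx (rsubmx : {linear 'rV[R]_(n + n) -> 'rV[R]_n}) z.
  have := is_diff_row_mx rd (is_diff_cst (0 : 'rV[R]_n) z).
  exact.
have Fd := smooth_is_diff Fs Oz.
have Ed := is_diff_Dv_app Fs Oz Yd.
have := is_diff_row_mx Fd Ed.
move=> h; refine (etrans (is_diff_Dv w (near_eq_is_diff _ h)) _).
  apply: (open_near_eq oO Oz) => y; rewrite inE => -[v [iv jv] <-].
  rewrite (locE slit_smooth_atlas)// (slit_transE iv jv) Dv_lsubmx; last first.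
    by rewrite /= row_mxKl; exists (foot v).
  by rewrite /F /Y /= !row_mxKl row_mxKr.
rewrite Dv_Dv_lsubmx// !Dv_lsubmx; [|exact: slit_img_base Oz..].
by rewrite /Y !row_mxKl lzE rzE.
Qed.

End SlitAtlas.

(** * Vertical derivatives *)

Section VerticalCalculus.
Context {R : realType} {n : nat} {M : Type} {A : atlas R n M}.
Hypothesis hA : smooth_atlas A.
Local Notation B := (slit_atlas A).
Let hB : smooth_atlas B := slit_smooth_atlas hA.
Implicit Types (i : chart_index A) (u : slit A) (f : slit A -> R)
  (X Y Z : slit A -> vec A) (V W : slit A -> vec B).

(** In coordinates, X^k dY^i / dy^k. *)
Definition vd X Y : slit A -> vec A := fun u i =>
  Dv (loc (A := B) i (fun w => Y w i)) (coord (a := B) i u) (row_mx 0 (X u i)).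

Definition vdf X f : slit A -> R := fun u => dir u (gamma X u) f.

Lemma pvD X Y : pi_vfield X -> pi_vfield Y -> pi_vfield (fun u => X u + Y u : vec A).
Proof.
move=> [Xt Xs] [Yt Ys]; split=> [u|i]; first exact: tangentD.
exact: (smooth_inD hB).
Qed.

Lemma pvZ f X : smooth_fun B f -> pi_vfield X -> pi_vfield (fun u => f u *: X u : vec A).
Proof.
move=> fs [Xt Xs]; split=> [u|i]; first exact: tangentZ.
exact: (smooth_in_scale hB (fs i)).
Qed.

Lemma pvN X : pi_vfield X -> pi_vfield (fun u => - X u : vec A).
Proof.
move=> [Xt Xs]; split=> [u|i]; first exact: tangentN.
exact: (smooth_inN hB).
Qed.

Lemma pvB X Y : pi_vfield X -> pi_vfield Y -> pi_vfield (fun u => X u - Y u : vec A).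
Proof. by move=> Xv Yv; apply: pvD => //; exact: pvN. Qed.

Lemma pv0 : pi_vfield (fun u => 0 : vec A).
Proof. by split=> [u|i]; [exact: tangent0|exact: (smooth_in_cst hB)]. Qed.

Lemma eta_pv : pi_vfield (etabar A).
Proof.
split=> [u|i]; first exact: foot_tangent.
apply: (smooth_loc hB (h := rsubmx)) => [u iu|k]; first by rewrite /= row_mxKr.
apply: (@Ck_lin _ 'rV[R]_(n + n) 'rV[R]_n k _ rsubmx).
  exact: (img_open hB).
exact: linear_mx_continuous.
Qed.

Lemma rho_pv V : vfield V -> pi_vfield (rho V).
Proof.
move=> Vv; split=> [u|i].
  have Vt := vfield_tangent hB u Vv.
  apply: tangent_intro => [i iu|i j iu ju]; rewrite /rho /dpi.
    by rewrite (Vt.1 i iu) linear0.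
  by rewrite (tangent_trans Vt iu ju) (Dv_slit_trans hA)// row_mxKl.
exact: (smooth_in_lin hB lsubmx (Vv i).2).
Qed.

Lemma vlift_tangent u (v : vec A) : tangent (foot u) v -> tangent u (vlift v).
Proof.
move=> vt; apply: tangent_intro => [i iu|i j iu ju]; rewrite /vlift.
  by rewrite (vt.1 i iu) row_mx0.
rewrite (Dv_slit_trans hA)// row_mxKl row_mxKr !Dv0 add0r.
by rewrite (tangent_trans vt iu ju).
Qed.

Lemma gamma_vf X : pi_vfield X -> vfield (gamma X).
Proof.
move=> [Xt Xs]; apply: vfield_intro => [u|i]; first exact/vlift_tangent/Xt.
have -> : (fun u => gamma X u i) = (fun u => rowr (X u i)).
  by apply/funext => u; rewrite rowrE.
exact: (smooth_in_lin hB rowr (Xs i)).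
Qed.

Lemma dpi_vlift (v : vec A) : dpi (vlift v) = 0.
Proof. by apply/funext => i; rewrite /dpi /vlift row_mxKl. Qed.

Lemma Dv_gamma i u X w : dom i (foot u) -> pi_vfield X ->
  Dv (loc (A := B) i (fun q => gamma X q i)) (coord (a := B) i u) w =
  row_mx 0 (Dv (loc (A := B) i (fun q => X q i)) (coord (a := B) i u) w).
Proof.
move=> iu [Xt Xs]; rewrite -rowrE -(Dv_loc_lin hB rowr _ _ (Xs i))//.
by congr (Dv (loc _ _)); apply/funext => q; rewrite rowrE.
Qed.

Lemma vd_out X Y u i : pi_vfield X -> ~ dom i (foot u) -> vd X Y u i = 0.
Proof. by move=> [Xt _] iu; rewrite /vd ((Xt u).1 i iu) row_mx0 Dv0. Qed.

(** The base components of [gamma X] vanish identically, so only V is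
    differentiated. *)
Lemma rho_bracket_gamma X V : pi_vfield X -> vfield V ->
  rho (bracket (gamma X) V) = vd X (rho V).
Proof.
move=> Xv Vv; apply/funext => u; apply/funext => i.
have [iu|iu] := pselect (dom i (foot u)); last first.
  rewrite vd_out//; have := vfield_tangent hB u (bracket_vfield hB (gamma_vf Xv) Vv).
  by move=> [/(_ i iu) b0 _]; rewrite /rho /dpi b0 linear0.
rewrite /rho /dpi bracketE linearB /= Dv_gamma// row_mxKl subr0.
by rewrite -(Dv_loc_lin hB lsubmx _ iu (Vv i).2).
Qed.

Lemma bracket_gamma X Y : pi_vfield X -> pi_vfield Y ->
  bracket (gamma X) (gamma Y) = gamma (fun u => vd X Y u - vd Y X u : vec A).
Proof.
move=> Xv Yv; apply/funext => u; apply/funext => i.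
have [iu|iu] := pselect (dom (a := A) i (foot u)); last first.
  have := vfield_tangent hB u (bracket_vfield hB (gamma_vf Xv) (gamma_vf Yv)).
  move=> [/(_ i iu) -> _]; rewrite /gamma /vlift !fctE /=.
  by rewrite !vd_out// subr0 row_mx0.
rewrite bracketE !Dv_gamma// /gamma /vlift !fctE /= /vd /=.
by rewrite opp_row_mx add_row_mx subr0.
Qed.

Lemma vd_eta X : pi_vfield X -> vd X (etabar A) = X.
Proof.
move=> Xv; apply/funext => u; apply/funext => i.
have [iu|iu] := pselect (dom i (foot u)); last first.
  by rewrite vd_out// (Xv.1 u).1.
have h : is_diff (coord (a := B) i u) (loc (A := B) i (fun w => etabar A w i)) rsubmx.
  apply: (is_diff_loc hB (h := rsubmx)) => //.
    by move=> q iq; rewrite /= row_mxKr.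
  exact: (is_diff_lin_mx rsubmx).
by rewrite /vd (is_diff_Dv _ h) row_mxKr.
Qed.

(** The transition maps of the pulled back bundle are constant along the fibres,
    so that vertical differentiation commutes with them. *)
Lemma vd_pv X Y : pi_vfield X -> pi_vfield Y -> pi_vfield (vd X Y).
Proof.
move=> Xv Yv; split=> [u|i]; last first.
  exact: (smooth_in_Dv hB (Yv.2 i) ((gamma_vf Xv) i).2).
apply: tangent_intro => [i iu|i j iu ju]; first exact: vd_out.
have iuB : dom (a := B) i u by [].
have juB : dom (a := B) j u by [].
have Gt := vlift_tangent (Xv.1 u).
have E := is_diff_Dv (vlift (X u) i)
  (is_diff_chart hB iuB juB (is_diff_smooth_in juB (Yv.2 j))).
rewrite /= in E.
rewrite /vd -/(vlift (X u) j) (tangent_trans Gt iuB juB) -E.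
pose F (z : 'rV[R]_(n + n)) := loc i (coord j : M -> 'rV[R]_n) (lsubmx z).
set O := coord (a := B) i @` (dom (a := B) i `&` dom (a := B) j).
have oO : open O by exact: (sa_open hB).
have Oz : O (coord (a := B) i u) by exists u.
have Fs : smooth_on O F by exact: trans_lsubmx_smooth.
have Yd := is_diff_smooth_in iuB (Yv.2 i).
have Yd' := is_diff_comp Yd (is_diff_lin_mx (rowl : {linear 'rV[R]_n -> 'rV[R]_(n + n)}) _).
have h := is_diff_Dv_app Fs Oz Yd'.
refine (etrans (is_diff_Dv _ (near_eq_is_diff _ h)) _).
  apply: (open_near_eq oO Oz) => y; rewrite inE => -[w [iw jw] <-]; rewrite /comp.
  rewrite !(locE hB)// (tangent_trans (Yv.1 w) iw jw) rowlE (Dv_lsubmx hA); last first.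
    by rewrite /= row_mxKl; exists (foot w).
  by rewrite /= !row_mxKl.
rewrite /comp !rowlE (Dv_lsubmx hA) ?row_mxKl; last by exists (foot u).
rewrite (Dv_Dv_lsubmx hA)//.
have l0 : lsubmx (vlift (X u) i) = 0 by exact: row_mxKl.
by rewrite [X in X + _](etrans (congr1 (Dv _ _) l0) (Dv0 _ _)) add0r.
Qed.

Lemma vdZr X f Y u : pi_vfield X -> smooth_fun B f -> pi_vfield Y ->
  vd X (fun u => f u *: Y u : vec A) u = f u *: vd X Y u + vdf X f u *: Y u.
Proof.
move=> Xv fs Yv; apply/funext => i.
have [iu|iu] := pselect (dom i (foot u)); last first.
  by rewrite !fctE /= !vd_out// (Yv.1 u).1// !scaler0 addr0.
have iuB : dom (a := B) i u by [].
apply: etrans (is_diff_Dv _ (is_diff_loc_scale hB iuB (is_diff_smooth_in iuB (fs i))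
  (is_diff_smooth_in iuB (Yv.2 i)))) _.
rewrite !fctE /= /vdf (dirE hB fs iuB)//.
exact: vlift_tangent (Xv.1 u).
Qed.

Lemma vdDl X Y Z u : vd (fun w => X w + Y w : vec A) Z u = vd X Z u + vd Y Z u.
Proof.
apply/funext => i; rewrite /vd !fctE /= -DvD; congr Dv.
by rewrite add_row_mx addr0.
Qed.

Lemma vdZl X f Z u : vd (fun w => f w *: X w : vec A) Z u = f u *: vd X Z u.
Proof.
apply/funext => i; rewrite /vd !fctE /= -DvZ; congr Dv.
by rewrite scale_row_mx scaler0.
Qed.

Lemma vdBl X Y Z u : vd (fun w => X w - Y w : vec A) Z u = vd X Z u - vd Y Z u.
Proof.
rewrite (vdDl X (fun w => - Y w : vec A)); congr (_ + _).
have := vdZl Y (fun=> - 1) Z u; rewrite scaleN1r => <-.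
by congr (vd _ Z u); apply/funext => w; rewrite scaleN1r.
Qed.

(** The fibres are flat: the second derivatives of Z commute. *)
Lemma vd_flat X Y Z u : pi_vfield X -> pi_vfield Y -> pi_vfield Z ->
  vd X (vd Y Z) u - vd Y (vd X Z) u = vd (fun w => vd X Y w - vd Y X w : vec A) Z u.
Proof.
move=> Xv Yv Zv; apply/funext => i; rewrite !fctE /=.
have XYv : pi_vfield (fun w => vd X Y w - vd Y X w : vec A).
  by apply: pvB; exact: vd_pv.
have [iu|iu] := pselect (dom i (foot u)); last first.
  by rewrite !vd_out// subr0.
have iuB : dom (a := B) i u by [].
have E X' Y' : pi_vfield X' -> pi_vfield Y' -> vd X' (vd Y' Z) u i =
    Dv (fun z => Dv (loc (A := B) i (fun w => Z w i)) z (vlift (Y' u) i))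
      (coord (a := B) i u) (vlift (X' u) i)
    + Dv (loc (A := B) i (fun w => Z w i)) (coord (a := B) i u)
        (row_mx 0 (vd X' Y' u i)).
  move=> Xv' Yv'.
  have h := is_diff_loc_Dv hB iuB (Zv.2 i) ((gamma_vf Yv') i).2.
  by apply: etrans (is_diff_Dv _ h) _; rewrite Dv_gamma.
rewrite !E//.
have Oz : (coord (a := B) i @` dom (a := B) i) (coord (a := B) i u) by exists u.
rewrite (Dv_sym_rV _ _ (img_open hB i) (Zv.2 i) Oz).
rewrite opprD addrACA subrr add0r -DvB; congr Dv.
by rewrite opp_row_mx add_row_mx subr0.
Qed.

Lemma vdf_smooth X f : pi_vfield X -> smooth_fun B f -> smooth_fun B (vdf X f).
Proof. by move=> Xv fs; apply: (dirf_smooth hB) => //; exact: gamma_vf. Qed.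

Lemma vdfDl X Y f u : vdf (fun w => X w + Y w : vec A) f u = vdf X f u + vdf Y f u.
Proof.
rewrite /vdf -[dir _ (gamma X u) f]mul1r -(dir_lin (B := B)) scale1r; congr dir.
by apply/funext => i; rewrite !fctE /= /gamma /vlift add_row_mx addr0.
Qed.

Lemma vdfZl g X f u : vdf (fun w => g w *: X w : vec A) f u = g u * vdf X f u.
Proof.
have := dir_lin (B := B) u (g u) (gamma X u) 0 f.
rewrite !addr0 dir0 addr0 => <-; congr dir.
by apply/funext => i; rewrite !fctE /= /gamma /vlift scale_row_mx scaler0.
Qed.

Lemma vdfBl X Y f u : vdf (fun w => X w - Y w : vec A) f u = vdf X f u - vdf Y f u.
Proof.
rewrite (vdfDl X (fun w => - Y w : vec A)); congr (_ + _).
have := vdfZl (fun=> - 1) Y f u; rewrite mulN1r => <-.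
by congr (vdf _ f u); apply/funext => w; rewrite scaleN1r.
Qed.

Lemma vdf_comm X Y f u : pi_vfield X -> pi_vfield Y -> smooth_fun B f ->
  vdf X (vdf Y f) u - vdf Y (vdf X f) u = vdf (vd X Y) f u - vdf (vd Y X) f u.
Proof.
move=> Xv Yv fs; rewrite -vdfBl /vdf -bracket_gamma//.
by rewrite (dir_bracket hB)//; exact: gamma_vf.
Qed.

Lemma vdfD X f g u : smooth_fun B f -> smooth_fun B g ->
  vdf X (fun q => f q + g q) u = vdf X f u + vdf X g u.
Proof. exact: (dir_add hB). Qed.

Lemma vdfM X f g u : smooth_fun B f -> smooth_fun B g ->
  vdf X (fun q => f q * g q) u = f u * vdf X g u + g u * vdf X f u.
Proof. exact: (dir_mul hB). Qed.

Lemma vdf_cst X c u : vdf X (fun=> c) u = 0.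
Proof. exact: (dir_cst hB). Qed.

Lemma vdfMc X c g u : smooth_fun B g -> vdf X (fun q => c * g q) u = c * vdf X g u.
Proof.
move=> gs; rewrite vdfM ?vdf_cst ?mulr0 ?addr0//; exact: (smooth_fun_cst hB).
Qed.

End VerticalCalculus.

(** Identifying these scalars up to conversion would unfold differentials. *)
Ltac abstract_scalars := repeat match goal with
  | |- context [vdf ?X ?f ?u] => generalize (vdf X f u); intro
  | |- context [gdot ?L ?X ?Y ?u] => generalize (gdot L X Y u); intro
  | |- context [dir ?u ?X ?f] => generalize (dir u X f); intro
  end.

(** * The Finsler metric as a vertical Hessian *)

Section Metric.
Context {R : realType} {n : nat} {M : Type} {A : atlas R n M}.
Hypothesis hA : smooth_atlas A.
Local Notation B := (slit_atlas A).
Let hB : smooth_atlas B := slit_smooth_atlas hA.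
Context (L : slit A -> R).
Hypothesis hL : finsler L.
Local Notation L2 := (fun t => L t ^+ 2).
Local Notation eta := (etabar A).
Implicit Types (i : chart_index A) (u : slit A) (f : slit A -> R)
  (X Y Z : slit A -> vec A).

Lemma energy_smooth : smooth_fun B L2.
Proof.
have -> : L2 = fun t => L t * L t by apply/funext => t; rewrite expr2.
by apply: (smooth_funM hB); exact: finsler_smooth hL.
Qed.
Let Ls := energy_smooth.

Lemma gdot_Dv X Y u (c := chart_at A (foot u)) : gdot L X Y u =
  2^-1 * Dv (fun z => Dv (loc (A := B) c (L2 : slit A -> R^o)) z (row_mx 0 (Y u c)))
    (coord (a := B) c u) (row_mx 0 (X u c)).
Proof.
have E : (fun z => 'd (loc (A := B) c (L2 : slit A -> R^o)) z (row_mx 0 (Y u c))) =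
    (fun z => Dv (loc (A := B) c (L2 : slit A -> R^o)) z (row_mx 0 (Y u c))).
  by apply/funext => z; rewrite DvE.
by rewrite DvE -E.
Qed.

(** The metric as the vertical Hessian of L^2 / 2, in a form free of charts. *)
Lemma gdotE Y Z u : pi_vfield Y -> pi_vfield Z ->
  gdot L Y Z u = 2^-1 * (vdf Y (vdf Z L2) u - vdf (vd Y Z) L2 u).
Proof.
move=> Yv Zv; rewrite gdot_Dv; congr (_ * _).
set c := chart_at A (foot u); have cu : dom (a := B) c u by exact: (sa_chart hA).
rewrite /vdf (dirE hB (dirf_smooth hB (gamma_vf hA Zv) Ls) cu); last first.
  have H := vfield_tangent hB u (gamma_vf hA Yv).
  exact: H.
rewrite (Dv_dir hB _ cu (gamma_vf hA Zv) Ls) (Dv_gamma hA)//.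
by rewrite dir_Dv addrK.
Qed.

Lemma gdot_smooth Y Z : pi_vfield Y -> pi_vfield Z -> smooth_fun B (gdot L Y Z).
Proof.
move=> Yv Zv.
have -> : gdot L Y Z = fun u => 2^-1 * (vdf Y (vdf Z L2) u + (-1) * vdf (vd Y Z) L2 u).
  by apply/funext => u; rewrite gdotE// mulN1r.
apply: (smooth_funM hB); first exact: (smooth_fun_cst hB).
apply: (smooth_funD hB); first by do 2!apply: vdf_smooth => //.
apply: (smooth_funM hB); first exact: (smooth_fun_cst hB).
by apply: vdf_smooth => //; exact: vd_pv.
Qed.

Lemma gdotC Y Z u : pi_vfield Y -> pi_vfield Z -> gdot L Y Z u = gdot L Z Y u.
Proof.
move=> Yv Zv; rewrite !gdotE//; congr (_ * _).
have := vdf_comm hA u Yv Zv Ls.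
by abstract_scalars; lra.
Qed.

Lemma gdotDl X Y Z u :
  gdot L (fun w => X w + Y w : vec A) Z u = gdot L X Z u + gdot L Y Z u.
Proof.
rewrite !gdot_Dv -mulrDr -DvD; congr (_ * _); congr Dv.
by rewrite add_row_mx addr0.
Qed.

Lemma gdotZl f X Z u : gdot L (fun w => f w *: X w : vec A) Z u = f u * gdot L X Z u.
Proof.
rewrite !gdot_Dv [RHS]mulrCA; congr (_ * _).
apply: etrans (DvZ _ _ _ _) => //; congr Dv.
by rewrite scale_row_mx scaler0.
Qed.

Lemma gdotNl X Z u : gdot L (fun w => - X w : vec A) Z u = - gdot L X Z u.
Proof.
rewrite -mulN1r -(gdotZl (fun=> -1)); congr (gdot _ _ _ _).
by apply/funext => w; rewrite scaleN1r.
Qed.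

Lemma gdotBl X Y Z u :
  gdot L (fun w => X w - Y w : vec A) Z u = gdot L X Z u - gdot L Y Z u.
Proof. by rewrite (gdotDl X (fun w => - Y w : vec A)) gdotNl. Qed.

Lemma gdotDr X Y Z u : pi_vfield X -> pi_vfield Y -> pi_vfield Z ->
  gdot L Z (fun w => X w + Y w : vec A) u = gdot L Z X u + gdot L Z Y u.
Proof.
by move=> Xv Yv Zv; rewrite gdotC ?gdotDl ?(@gdotC Z)//; exact: pvD.
Qed.

Lemma gdotZr f X Z u : smooth_fun B f -> pi_vfield X -> pi_vfield Z ->
  gdot L Z (fun w => f w *: X w : vec A) u = f u * gdot L Z X u.
Proof.
by move=> fs Xv Zv; rewrite gdotC ?gdotZl ?(@gdotC Z)//; exact: pvZ.
Qed.

Lemma gdotNr X Z u : pi_vfield X -> pi_vfield Z ->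
  gdot L Z (fun w => - X w : vec A) u = - gdot L Z X u.
Proof. by move=> Xv Zv; rewrite gdotC ?gdotNl ?(@gdotC Z)//; exact: pvN. Qed.

Lemma gdotBr X Y Z u : pi_vfield X -> pi_vfield Y -> pi_vfield Z ->
  gdot L Z (fun w => X w - Y w : vec A) u = gdot L Z X u - gdot L Z Y u.
Proof.
by move=> Xv Yv Zv; rewrite gdotC ?gdotBl ?(@gdotC Z)//; exact: pvB.
Qed.

Lemma gdot0l Z u : gdot L (fun=> 0 : vec A) Z u = 0.
Proof.
have := gdotZl (fun=> 0) Z Z u; rewrite mul0r => <-; congr (gdot _ _ _ _).
by apply/funext => w; rewrite scale0r.
Qed.

Lemma gdot0r Z u : pi_vfield Z -> gdot L Z (fun=> 0 : vec A) u = 0.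
Proof. by move=> Zv; rewrite gdotC ?gdot0l//; exact: pv0. Qed.

Lemma gdot_eq0 X : pi_vfield X -> (forall u, gdot L X X u = 0) -> X = fun=> 0.
Proof.
move=> Xv X0; apply/funext => u; apply: contrapT => Xu.
by have := finsler_posdef hL (Xv.1 u) Xu; rewrite [fmetric _ _ _ _]X0 ltxx.
Qed.

Lemma gdot_ge0 X u : pi_vfield X -> 0 <= gdot L X X u.
Proof.
move=> Xv; have [Xu|Xu] := pselect (X u = 0).
  rewrite gdot_Dv Xu.
  by rewrite [row_mx _ _](_ : _ = 0) ?Dv0 ?mulr0// row_mx0.
exact/ltW/(finsler_posdef hL (Xv.1 u)).
Qed.

(** Homogeneity of degree 2, differentiated at t = 0 along t |-> (1 + t) u. *)
Lemma euler u : vdf eta L2 u = 2 * L u ^+ 2.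
Proof.
rewrite /vdf dir_Dv; set c := chart_at _ _.
have cu : dom (a := B) c u by exact: (sa_chart hA).
set z := coord (a := B) c u; set v := gamma eta u c.
have Oz : (coord (a := B) c @` dom (a := B) c) z by exists u.
pose F := loc (A := B) c (L2 : slit A -> R^o).
have Fd : differentiable F z by exact: smooth_differentiable (Ls c) Oz.
have Fd0 : differentiable F ((0 : R) *: v + z) by rewrite scale0r add0r.
have hd := is_derive_line Fd0.
have g0 : \forall t \near (0 : R), F (t *: v + z) = (1 + t) ^+ 2 * L u ^+ 2.
  near=> t.
  have t1 : 0 < 1 + t.
    have : -1 < t by near: t; apply: lt_nbhsr; rewrite oppr_lt0 ltr01.
    by rewrite addrC -ltrBlDr sub0r.
  have tn : tangent (foot u) ((1 + t) *: fib u) by exact/tangentZ/foot_tangent.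
  have t0 : (1 + t) *: fib u <> 0.
    by move/eqP; rewrite scaler_eq0 gt_eqF//= => /eqP; case: (svalP u).
  pose w : slit A := exist _ (foot u, (1 + t) *: fib u) (conj tn t0).
  have -> : t *: v + z = coord (a := B) c w.
    rewrite /v /z /gamma /vlift /= scale_row_mx scaler0 add_row_mx add0r.
    by rewrite /etabar /foot /fib /= !fctE /= scalerDl scale1r addrC.
  rewrite /F (locE hB)//.
  have -> : L w = (1 + t) * L u by exact: finsler_homogeneous.
  by rewrite exprMn.
have pd : is_derive (0 : R) 1 (fun t : R => (1 + t) ^+ 2 * L u ^+ 2) (2 * L u ^+ 2).
  have i1 : is_derive (0 : R) 1 (cst 1 + id : R -> R) (0 + 1) by exact: is_deriveD.
  have h := is_deriveZ (L u ^+ 2) (is_deriveX 2 i1).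
  have -> : (fun t : R => (1 + t) ^+ 2 * L u ^+ 2) = L u ^+ 2 \*: (cst 1 + id) ^+ 2.
    by apply/funext => t; rewrite /= !fctE /= mulrC.
  apply: (is_derive_eq h).
  by rewrite !fctE /= addr0 add0r expr1 !mulr1 /GRing.scale /= mulr1 mulrC.
have hd' := near_eq_is_derive g0 hd.
have := @derive_val _ _ _ _ _ _ _ pd.
have := @derive_val _ _ _ _ _ _ _ hd'.
by move=> -> <-; rewrite scale0r add0r DvE.
Unshelve. all: by end_near. Qed.

Lemma gdot_eta Z u : pi_vfield Z -> gdot L Z eta u = 2^-1 * vdf Z L2 u.
Proof.
move=> Zv; rewrite gdotE//; last exact: eta_pv; congr (_ * _).
have -> : vdf eta L2 = fun u => 2 * L u ^+ 2 by apply/funext => w; rewrite euler.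
by rewrite (vd_eta hA)// (vdfMc hA)//; abstract_scalars; ring.
Qed.

(** Here g(Z, eta) is the first vertical derivative of L^2 / 2 and g the
    second one. *)
Lemma vdf_gdot_eta X Z u : pi_vfield X -> pi_vfield Z ->
  vdf X (gdot L Z eta) u = gdot L X Z u + gdot L (vd X Z) eta u.
Proof.
move=> Xv Zv.
have -> : gdot L Z eta = fun u => 2^-1 * vdf Z L2 u.
  by apply/funext => w; rewrite gdot_eta.
rewrite (vdfMc hA); last exact: vdf_smooth.
rewrite gdot_eta ?gdotE//; last exact: vd_pv.
by abstract_scalars; ring.
Qed.

(** Twice the Cartan tensor with its index lowered. *)
Definition vdg X Y Z : slit A -> R := fun u =>
  vdf X (gdot L Y Z) u - gdot L (vd X Y) Z u - gdot L Y (vd X Z) u.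

Lemma vdgE X Y Z u : pi_vfield X -> pi_vfield Y -> pi_vfield Z ->
  vdg X Y Z u = 2^-1 * (vdf X (vdf Y (vdf Z L2)) u - vdf X (vdf (vd Y Z) L2) u
    - (vdf (vd X Y) (vdf Z L2) u - vdf (vd (vd X Y) Z) L2 u)
    - (vdf Y (vdf (vd X Z) L2) u - vdf (vd Y (vd X Z)) L2 u)).
Proof.
move=> Xv Yv Zv.
have XYv := vd_pv hA Xv Yv; have XZv := vd_pv hA Xv Zv; have YZv := vd_pv hA Yv Zv.
rewrite /vdg !gdotE//.
have -> : gdot L Y Z = fun u => 2^-1 * (vdf Y (vdf Z L2) u + -1 * vdf (vd Y Z) L2 u).
  by apply/funext => w; rewrite gdotE// mulN1r.
have s1 : smooth_fun B (vdf Y (vdf Z L2)) by do 2!apply: vdf_smooth => //.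
have s2 : smooth_fun B (vdf (vd Y Z) L2) by apply: vdf_smooth.
have s3 : smooth_fun B (fun u => -1 * vdf (vd Y Z) L2 u).
  by apply: (smooth_funM hB) => //; exact: (smooth_fun_cst hB).
rewrite (vdfMc hA); last exact: (smooth_funD hB).
by rewrite (vdfD hA)// (vdfMc hA)//; abstract_scalars; ring.
Qed.

(** As the third vertical derivative of L^2 / 2, [vdg] is symmetric because the
    fibres are flat. *)
Lemma vdg_sym X Y Z u : pi_vfield X -> pi_vfield Y -> pi_vfield Z ->
  vdg X Y Z u = vdg Y X Z u.
Proof.
move=> Xv Yv Zv.
have XYv := vd_pv hA Xv Yv; have YXv := vd_pv hA Yv Xv.
rewrite !vdgE//; congr (_ * _).
have := vdf_comm hA u Xv Yv (vdf_smooth hA Zv Ls).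
have := vdfBl (vd X (vd Y Z)) (vd Y (vd X Z)) L2 u.
have -> : (fun w => vd X (vd Y Z) w - vd Y (vd X Z) w : vec A) =
    (fun w => vd (vd X Y) Z w - vd (vd Y X) Z w).
  by apply/funext => w; rewrite vd_flat// vdBl.
by rewrite vdfBl; abstract_scalars; lra.
Qed.

Lemma vdg_symr X Y Z u : pi_vfield X -> pi_vfield Y -> pi_vfield Z ->
  vdg X Y Z u = vdg X Z Y u.
Proof.
move=> Xv Yv Zv.
have XYv := vd_pv hA Xv Yv; have XZv := vd_pv hA Xv Zv.
have E : gdot L Y Z = gdot L Z Y by apply/funext => w; rewrite gdotC.
by rewrite /vdg E (@gdotC Y)// (@gdotC _ Z)// addrAC.
Qed.

(** Infinitesimal form of the homogeneity of degree 0 of g, with eta moved to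
    another slot by symmetry. *)
Lemma vdg_eta X Z u : pi_vfield X -> pi_vfield Z -> vdg X eta Z u = 0.
Proof.
move=> Xv Zv; have etav := eta_pv hA; have XZv := vd_pv hA Xv Zv.
rewrite vdg_symr// /vdg vdf_gdot_eta// (vd_eta hA)// (@gdotC Z X)//.
by abstract_scalars; ring.
Qed.

Lemma vdgZl f X Y Z u : smooth_fun B f -> pi_vfield X -> pi_vfield Y -> pi_vfield Z ->
  vdg (fun w => f w *: X w : vec A) Y Z u = f u * vdg X Y Z u.
Proof.
move=> fs Xv Yv Zv; rewrite /vdg vdfZl.
have E W : vd (fun w => f w *: X w : vec A) W = fun w => f w *: vd X W w : vec A.
  by apply/funext => w; rewrite vdZl.
rewrite !E gdotZl gdotZr//; last exact: vd_pv.
by abstract_scalars; ring.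
Qed.

End Metric.

(** * Smoothness of horizontal lifts *)

Section SmoothInverse.
Context {R : realType} {V : normedModType R}.
Implicit Types (O : set V).

Lemma Ck_det k O m (G : V -> 'M[R]_m) : open O ->
  (forall a b, Ck k O (fun z => G z a b : R^o)) ->
  Ck k O (fun z => \det (G z) : R^o).
Proof.
move=> oO Gk; apply: Ck_sum => // s; apply: Ck_scale => //; first exact: Ck_cst.
exact: Ck_prod.
Qed.

(** Cramer's formula expresses the inverse by determinants. *)
Lemma Ck_invmx k O m (G : V -> 'M[R]_m) a b : open O ->
  (forall a b, Ck k O (fun z => G z a b : R^o)) ->
  (forall z, O z -> \det (G z) != 0) ->
  Ck k O (fun z => invmx (G z) a b : R^o).
Proof.
move=> oO Gk G0.
apply: (@Ck_congr _ _ _ _ _ (fun z => (\det (G z))^-1 *: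
    (((-1) ^+ (b + a) : R^o) *: (\det (row' b (col' a (G z))) : R^o)))) => //.
  move=> z; rewrite inE => Oz; rewrite /invmx unitmxE unitfE G0// !mxE.
  by rewrite /cofactor.
apply: Ck_scale => //; first by apply: Ck_inv => //; exact: Ck_det.
apply: Ck_scale => //; first exact: Ck_cst.
apply: Ck_det => // c d.
by under eq_fun do rewrite !mxE; exact: Gk.
Qed.

End SmoothInverse.

Section Connection.
Context {R : realType} {n : nat} {M : Type} {A : atlas R n M}.
Hypothesis hA : smooth_atlas A.
Local Notation B := (slit_atlas A).
Let hB : smooth_atlas B := slit_smooth_atlas hA.
Local Notation eta := (etabar A).
Context (D : connection A).
Hypotheses (hD : linear_connection D) (hreg : regular D).
Implicit Types (i : chart_index A) (u : slit A) (xi : vec B)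
  (X Y Z s : slit A -> vec A) (V W : slit A -> vec B).

Lemma conn0l u s : pi_vfield s -> D u 0 s = 0.
Proof.
move=> sv; have := conn_linear hD 1 (tangent0 B u) (tangent0 B u) sv.
by rewrite !scale1r addr0 => /eqP; rewrite -subr_eq subrr => /eqP.
Qed.

Lemma connDl u xi xi' s : tangent u xi -> tangent u xi' -> pi_vfield s ->
  D u (xi + xi') s = D u xi s + D u xi' s.
Proof.
by move=> xt xt' sv; have := conn_linear hD 1 xt xt' sv; rewrite !scale1r.
Qed.

Lemma connZl u a xi s : tangent u xi -> pi_vfield s -> D u (a *: xi) s = a *: D u xi s.
Proof.
move=> xt sv; have := conn_linear hD a xt (tangent0 B u) sv.
by rewrite !addr0 conn0l// addr0.
Qed.

Lemma connBl u xi xi' s : tangent u xi -> tangent u xi' -> pi_vfield s ->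
  D u (xi - xi') s = D u xi s - D u xi' s.
Proof.
move=> xt xt' sv; rewrite connDl//; last exact: tangentN.
by rewrite -scaleN1r connZl// scaleN1r.
Qed.

Lemma conn0r u xi : tangent u xi -> D u xi (fun=> 0 : vec A) = 0.
Proof.
move=> xt; have pz := pv0 hA; have := conn_add hD xt pz pz.
rewrite (_ : (fun=> 0) + (fun=> 0) = (fun=> 0 : vec A)); last first.
  by apply/funext => w; exact: addr0.
by move=> /eqP; rewrite -subr_eq subrr => /eqP.
Qed.

Lemma cov_pv V s : vfield V -> pi_vfield s -> pi_vfield (cov D V s).
Proof.
move=> Vv sv; split=> [u|i]; last exact: conn_smooth hD _ _ _ (Vv i) sv.
exact: conn_tangent hD _ _ _ (vfield_tangent hB u Vv) sv.
Qed.

Lemma dpi_tangent u xi : tangent u xi -> tangent (foot u) (dpi xi).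
Proof.
move=> xt; apply: tangent_intro => [i iu|i j iu ju]; rewrite /dpi.
  by rewrite (xt.1 i iu) linear0.
by rewrite (tangent_trans xt iu ju) (Dv_slit_trans hA)// row_mxKl.
Qed.

Lemma horizontal_inj u xi xi' : horizontal D u xi -> horizontal D u xi' ->
  dpi xi = dpi xi' -> xi = xi'.
Proof.
move=> [xt xh] [xt' xh'] xx'; apply/eqP; rewrite -subr_eq0; apply/eqP.
apply: (hreg u).2; split; first exact: tangentB.
- apply/funext => i; have := congr1 (@^~ i) xx'; rewrite /dpi !fctE /= => E.
  by rewrite linearB /= E subrr.
- exact: tangentB.
- by rewrite connBl ?xh ?xh' ?subrr//; exact: eta_pv.
Qed.

Lemma horizontal_exists u (v : vec A) : tangent (foot u) v ->
  exists2 h, horizontal D u h & dpi h = v.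
Proof.
move=> vt; set c := chart_at A (foot u).
have cu : dom (a := B) c u by exact: (sa_chart hA).
have [xi xt xc] := tangent_extend hB (row_mx (v c) 0) cu.
have [w [h [[wt w0] hh E]]] := (hreg u).1 xi xt.
exists h => //; have ht := dpi_tangent hh.1.
apply: (@tangent_inj _ _ _ A c (foot u)) => //.
have := congr1 (fun x : vec B => lsubmx (x c)) E; rewrite xc row_mxKl => ->.
have := congr1 (@^~ c) w0; rewrite /dpi !fctE /= => w0c.
by rewrite linearD /= w0c add0r.
Qed.

Lemma betaP X u : tangent (foot u) (X u) ->
  horizontal D u (beta D X u) /\ dpi (beta D X u) = X u.
Proof.
move=> Xt; rewrite /beta; case: xgetP => [h _ //|].
have [h hh hX] := horizontal_exists Xt.
by move=> /(_ h)/=; case.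
Qed.

Lemma beta_unique X u xi : tangent (foot u) (X u) -> horizontal D u xi ->
  dpi xi = X u -> beta D X u = xi.
Proof.
move=> Xt xh xX; have [bh bX] := betaP Xt.
by apply: (horizontal_inj bh xh); rewrite bX.
Qed.

Definition chart_vec i u (w : 'rV[R]_(n + n)) : vec B :=
  xget 0 [set xi : vec B | tangent u xi /\ xi i = w].

Lemma chart_vecP i u w : dom i (foot u) ->
  tangent u (chart_vec i u w) /\ chart_vec i u w i = w.
Proof.
move=> iu; rewrite /chart_vec; case: xgetP => [xi _ //|].
have [xi xt xw] := tangent_extend hB w (iu : dom (a := B) i u).
by move=> /(_ xi)/=; case.
Qed.

Lemma chart_vecE i u xi : dom i (foot u) -> tangent u xi -> chart_vec i u (xi i) = xi.
Proof.
move=> iu xt; have [ct cE] := chart_vecP (xi i) iu.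
exact: (@tangent_inj _ _ _ B i u).
Qed.

Definition Kchart i u (w : 'rV[R]_(n + n)) : 'rV[R]_n := D u (chart_vec i u w) eta i.

Lemma Kchart_smooth i (w : slit A -> 'rV[R]_(n + n)) :
  smooth_in (A := B) i w -> smooth_in (A := B) i (fun u => Kchart i u (w u)).
Proof.
move=> ws; apply: (conn_smooth hD (X := fun u => chart_vec i u (w u))); last exact: eta_pv.
split=> [u iu|]; first exact: (chart_vecP _ iu).1.
apply: smooth_congr ws; first exact: (img_open hB).
by move=> _ [u iu <-]; rewrite !(locE hB)// (chart_vecP _ iu).2.
Qed.

Lemma KchartP i u a w w' : dom i (foot u) ->
  Kchart i u (a *: w + w') = a *: Kchart i u w + Kchart i u w'.
Proof.
move=> iu; rewrite /Kchart.
have [[ct cE] [ct' cE']] := (chart_vecP w iu, chart_vecP w' iu).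
have -> : chart_vec i u (a *: w + w') = a *: chart_vec i u w + chart_vec i u w'.
  rewrite -[RHS](chart_vecE iu); last exact: tangentP.
  by congr chart_vec; rewrite !fctE /= cE cE'.
by rewrite (conn_linear hD)//; exact: eta_pv.
Qed.

(** The rows are the images of the vertical basis vectors under the connection
    map. *)
Definition Kvert i u : 'M[R]_n := \matrix_(k < n) Kchart i u (row_mx 0 'e_k).

Lemma Kvert_mul i u (w : 'rV[R]_n) : dom i (foot u) ->
  Kchart i u (row_mx 0 w) = w *m Kvert i u.
Proof.
move=> iu.
have K0 : Kchart i u 0 = 0.
  have := KchartP 1 0 0 iu; rewrite !scale1r addr0 => /eqP.
  by rewrite -subr_eq subrr => /eqP.
have sumE (r : seq 'I_n) : Kchart i u (row_mx 0 (\sum_(k <- r) w 0 k *: 'e_k)) =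
    \sum_(k <- r) w 0 k *: Kchart i u (row_mx 0 'e_k).
  elim: r => [|k r IH]; first by rewrite !big_nil row_mx0 K0.
  rewrite !big_cons -IH -KchartP//; congr Kchart.
  by rewrite scale_row_mx scaler0 add_row_mx addr0.
rewrite {1}[w]row_sum_delta sumE mulmx_sum_row.
by apply: eq_bigr => k _; rewrite rowK.
Qed.

Lemma Kvert_det i u : dom i (foot u) -> \det (Kvert i u) != 0.
Proof.
move=> iu; apply/det0P => -[w w0]; rewrite -Kvert_mul// => Kw.
have [ct cE] := chart_vecP (row_mx 0 w) iu.
have c0 : chart_vec i u (row_mx 0 w) = 0.
  apply: (hreg u).2; split=> //.
    apply: (@tangent_inj _ _ _ A i (foot u)) => //.
    - exact: dpi_tangent.
    - exact: tangent0.
    - by rewrite /dpi cE row_mxKl.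
  apply: (@tangent_inj _ _ _ A i (foot u)) => //.
    by apply: (conn_tangent hD) => //; exact: eta_pv.
  exact: tangent0.
move: w0; have := congr1 rsubmx cE; rewrite c0 row_mxKr => <-.
by rewrite linear0 eqxx.
Qed.

(** Solves K (X, b) = 0 for the vertical part b: by regularity the matrix of K on
    vertical vectors is invertible. *)
Lemma beta_chart i X u : dom i (foot u) -> tangent (foot u) (X u) ->
  beta D X u i = row_mx (X u i) (- Kchart i u (row_mx (X u i) 0) *m invmx (Kvert i u)).
Proof.
move=> iu Xt; have [[bt bh] bX] := betaP Xt.
rewrite -[LHS]hsubmxK.
have la : lsubmx (beta D X u i) = X u i by rewrite -[RHS](congr1 (@^~ i) bX).
rewrite la; congr row_mx; set b := rsubmx _.
have : Kchart i u (beta D X u i) = 0 by rewrite /Kchart chart_vecE// bh.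
rewrite -[beta D X u i]hsubmxK la -/b.
have -> : row_mx (X u i) b = 1 *: row_mx (X u i) 0 + row_mx 0 b.
  by rewrite scale1r add_row_mx addr0 add0r.
rewrite KchartP// scale1r Kvert_mul// => /eqP; rewrite addrC addr_eq0 => /eqP <-.
by rewrite mulmxK// unitmxE unitfE Kvert_det.
Qed.

Lemma beta_vf X : pi_vfield X -> vfield (beta D X).
Proof.
move=> Xv; apply: vfield_intro => [u|i]; first exact: (betaP (Xv.1 u)).1.1.
have oO := img_open hB i.
have Ns : smooth_in (A := B) i (fun u => - Kchart i u (row_mx (X u i) 0)).
  apply: (smooth_inN hB); apply: Kchart_smooth.
  apply: (smooth_loc hB (h := fun z => row_mx (loc (A := B) i (fun u => X u i) z) 0)).
    by move=> u iu; rewrite (locE hB).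
  apply: smooth_row_mx => //; first exact: Xv.2.
  by move=> k; exact: Ck_cst.
have Gs a b : smooth_in (A := B) i (fun u => Kvert i u a b : R^o).
  have Ks : smooth_in (A := B) i (fun u => Kchart i u (row_mx 0 'e_a)).
    by apply: Kchart_smooth; exact: (smooth_in_cst hB).
  have -> : (fun u => Kvert i u a b : R^o) =
      fun u => mx_entry 0 b (Kchart i u (row_mx 0 'e_a)).
    by apply/funext => u; rewrite /mx_entry !mxE.
  move=> k; apply: (Ck_congr oO _ (Ck_entry 0 b oO (Ks k))).
  by move=> _ /[!inE] -[u iu <-] /=; rewrite !(locE hB).
apply: (smooth_loc hB (h := fun z => row_mx (loc (A := B) i (fun u => X u i) z)
   (loc (A := B) i (fun u => - Kchart i u (row_mx (X u i) 0)) z *m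
    invmx (\matrix_(a, b) loc (A := B) i (fun u => Kvert i u a b : R^o) z)))).
  move=> u iu; rewrite !(locE hB)// beta_chart//; last exact: Xv.1.
  congr (row_mx _ (_ *m invmx _)).
  by apply/matrixP => a b; rewrite mxE (locE hB).
apply: smooth_row_mx => //; first exact: Xv.2.
move=> k; apply: Ck_mx => // a b.
under eq_fun do rewrite mxE.
apply: Ck_sum => // c; apply: (@Ck_scale _ _ R^o) => //.
  exact: (Ck_entry a c oO (Ns k)).
apply: Ck_invmx => //.
  by move=> a' b'; under eq_fun do rewrite mxE; exact: Gs.
move=> _ [u iu <-].
rewrite (_ : \matrix_(_, _) _ = Kvert i u) ?Kvert_det//.
by apply/matrixP => a' b'; rewrite mxE (locE hB).
Qed.

End Connection.

(** * The Cartan connection and concurrent fields *)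

Lemma subfE (T : Type) (V : zmodType) (f g : T -> V) x : (f - g) x = f x - g x.
Proof. by []. Qed.

Lemma addfE (T : Type) (V : zmodType) (f g : T -> V) x : (f + g) x = f x + g x.
Proof. by []. Qed.

Lemma oppfE (T : Type) (V : zmodType) (f : T -> V) x : (- f) x = - f x.
Proof. by []. Qed.

Section Cartan.
Context {R : realType} {n : nat} {M : Type} {A : atlas R n M}.
Hypothesis hA : smooth_atlas A.
Local Notation B := (slit_atlas A).
Let hB : smooth_atlas B := slit_smooth_atlas hA.
Local Notation eta := (etabar A).
Context (L : slit A -> R) (D : connection A).
Hypotheses (hL : finsler L) (hC : cartan_connection L D).
Let hD := cartan_linear hC.
Let hreg := cartan_regular hC.
Let etav : pi_vfield eta := eta_pv hA.
Implicit Types (u : slit A) (X Y Z : slit A -> vec A) (V W : slit A -> vec B).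

Lemma rho_gamma X : rho (gamma X) = fun=> 0.
Proof. by apply/funext => u; exact: dpi_vlift. Qed.

Lemma rho_beta X : pi_vfield X -> rho (beta D X) = X.
Proof. by move=> Xv; apply/funext => u; exact: (betaP hA hreg (Xv.1 u)).2. Qed.

Lemma K_beta X : pi_vfield X -> cov D (beta D X) eta = fun=> 0.
Proof. by move=> Xv; apply/funext => u; exact: (betaP hA hreg (Xv.1 u)).1.2. Qed.

Let bv X : pi_vfield X -> vfield (beta D X) := beta_vf hA hD hreg (X := X).
Let gv X : pi_vfield X -> vfield (gamma X) := gamma_vf hA (X := X).

Let bt X u : pi_vfield X -> tangent u (beta D X u).
Proof. by move=> Xv; have H := vfield_tangent hB u (bv Xv); exact: H. Qed.

Let gt X u : pi_vfield X -> tangent u (gamma X u).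
Proof. by move=> Xv; have H := vfield_tangent hB u (gv Xv); exact: H. Qed.

Lemma Ttor_vd X Y : pi_vfield X -> pi_vfield Y ->
  Ttor D X Y = fun u => cov D (gamma X) Y u - vd X Y u : vec A.
Proof.
move=> Xv Yv; apply/funext => u; rewrite /Ttor /torsion.
rewrite (rho_bracket_gamma hA Xv (bv Yv)) rho_gamma (rho_beta Yv).
rewrite !subfE [cov D (beta D Y) (fun=> 0) u](_ : _ = 0) ?subr0//.
by apply: (conn0r hA hD); exact: bt.
Qed.

Lemma cartan_vdf X Y Z u : pi_vfield X -> pi_vfield Y -> pi_vfield Z ->
  vdf X (gdot L Y Z) u = gdot L (cov D (gamma X) Y) Z u + gdot L Y (cov D (gamma X) Z) u.
Proof. by move=> Xv Yv Zv; exact: (cartan_metric hC (gv Xv)). Qed.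

(** Metricity and the symmetry of T make 2 g(T(X, eta), Z) the vertical
    derivative of g in the direction X evaluated on (Z, eta), which is 0 by
    [vdf_gdot_eta]; and T(X, eta) = D_(gamma X) eta - X. *)
Lemma K_gamma X : pi_vfield X -> cov D (gamma X) eta = X.
Proof.
move=> Xv; have Kv := cov_pv hA hD (gv Xv) etav.
pose W := fun u => cov D (gamma X) eta u - X u : vec A.
have Wv : pi_vfield W by exact: pvB.
have TX : Ttor D X eta = W by rewrite Ttor_vd// vd_eta.
have key Z u : pi_vfield Z -> gdot L W Z u = 0.
  move=> Zv; have XZv := vd_pv hA Xv Zv; have cZv := cov_pv hA hD (gv Xv) Zv.
  have := congr1 (@^~ u) (cartan_T hC Xv etav Zv).
  rewrite /= TX (Ttor_vd Xv Zv) gdotBl.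
  have := cartan_vdf u Xv Zv etav.
  rewrite (vdf_gdot_eta hA hL)// (gdotC hA hL _ Zv Kv) /W gdotBl.
  by abstract_scalars; lra.
have W0 := gdot_eq0 hL Wv (fun u => key W u Wv).
apply/funext => u; have := congr1 (@^~ u) W0; rewrite /W /=.
by move/eqP; rewrite subr_eq0 => /eqP.
Qed.

Lemma hv_split V u : vfield V ->
  V u = beta D (rho V) u + gamma (cov D V eta) u.
Proof.
move=> Vv; have Vt := vfield_tangent hB u Vv.
have Kv := cov_pv hA hD Vv etav; have gKt := gt u Kv.
have rv := rho_pv hA Vv.
rewrite (beta_unique hA hD hreg (xi := V u - gamma (cov D V eta) u)) ?subrK//.
- exact: rv.1.
- split; first exact: tangentB.
  rewrite (connBl hD)//; have := congr1 (@^~ u) (K_gamma Kv); rewrite {1}/cov => ->.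
  by rewrite /cov subrr.
- apply/funext => i; rewrite /dpi /rho /dpi !fctE /= linearB /=.
  by rewrite row_mxKl subr0.
Qed.

Lemma cov_split V Y u : vfield V -> pi_vfield Y ->
  cov D V Y u = cov D (beta D (rho V)) Y u + cov D (gamma (cov D V eta)) Y u.
Proof.
move=> Vv Yv; rewrite {1}/cov (hv_split u Vv) (connDl hD)//.
- exact/bt/rho_pv.
- exact/gt/cov_pv.
Qed.

Lemma cov_beta_sym X Y u : pi_vfield X -> pi_vfield Y ->
  cov D (beta D X) Y u - cov D (beta D Y) X u = rho (bracket (beta D X) (beta D Y)) u.
Proof.
move=> Xv Yv; have := congr1 (@^~ u) (cartan_Q hC Xv Yv).
rewrite /Qtor /torsion !rho_beta// !subfE => /eqP.
by rewrite subr_eq0 => /eqP.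
Qed.

(** By [K_gamma], P-hat (rho V, Y) = - D_(beta rho V) Y + K [beta rho V, gamma Y],
    and T (K V, Y) = D_(gamma K V) Y - vd (K V) Y; the covariant derivatives of
    Y cancel. *)
Lemma berwaldE V Y u : vfield V -> pi_vfield Y ->
  berwald D V Y u = vd (cov D V eta) Y u +
    cov D (bracket (beta D (rho V)) (gamma Y)) eta u.
Proof.
move=> Vv Yv; have rv := rho_pv hA Vv; have Kv := cov_pv hA hD Vv etav.
rewrite /berwald /Phat /Pcurv /curvature /Kmap (Ttor_vd Kv Yv) (K_gamma Yv).
rewrite (K_beta rv) !(subfE, addfE, oppfE) (cov_split u Vv Yv).
rewrite [cov D (gamma Y) (fun=> 0) u](_ : _ = 0); last first.
  by apply: (conn0r hA hD); exact: gt.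
rewrite addr0 opprB; set a := cov _ _ Y u; set b := cov _ (gamma _) Y u.
set c := vd _ _ _; set d := cov _ (bracket _ _) _ _.
by rewrite [a + b + _]addrACA subrr add0r [b + d]addrC addrACA subrr addr0 addrC.
Qed.

Section Concurrent.
Context (zeta : slit A -> vec A) (hz : concurrent D zeta).
Let zv : pi_vfield zeta := concurrent_pi_vfield hz.
Local Notation p2 := (gdot L zeta zeta).
Local Notation th := (fun Z => gdot L Z zeta).

Lemma cov_zeta V : vfield V -> cov D V zeta = fun u => - rho V u : vec A.
Proof.
move=> Vv; apply/funext => u; rewrite (cov_split u Vv zv).
rewrite (concurrent_h hz (rho_pv hA Vv)) (concurrent_v hz (cov_pv hA hD Vv etav)).
exact: addr0.
Qed.

Lemma p2_smooth : smooth_fun B p2.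
Proof. exact: (gdot_smooth hA hL). Qed.

Lemma dir_theta V Z u : vfield V -> pi_vfield Z ->
  dir u (V u) (gdot L Z zeta) = gdot L (cov D V Z) zeta u - gdot L Z (rho V) u.
Proof.
move=> Vv Zv; rewrite (cartan_metric hC)// cov_zeta// (gdotNr hA hL)//.
exact: (rho_pv hA).
Qed.

Lemma dir_p2 V u : vfield V -> dir u (V u) p2 = -2 * gdot L (rho V) zeta u.
Proof.
move=> Vv; have rv := rho_pv hA Vv.
rewrite dir_theta// cov_zeta// gdotNl (gdotC hA hL _ zv rv).
by abstract_scalars; ring.
Qed.

(** This says that g(T(X, Y), zeta) = 0. It is the identity
    [V, W] f = V (W f) - W (V f) for V = gamma X, W = beta Y and f = p^2, the
    derivatives of p^2 being given by [dir_p2]. *)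
Lemma theta_cov_gamma X Y u : pi_vfield X -> pi_vfield Y ->
  gdot L (cov D (gamma X) Y) zeta u = gdot L (vd X Y) zeta u.
Proof.
move=> Xv Yv; have XYv := vd_pv hA Xv Yv.
have := dir_bracket hB u (gv Xv) (bv Yv) p2_smooth.
rewrite dir_p2; last exact: (bracket_vfield hB (gv Xv) (bv Yv)).
rewrite (rho_bracket_gamma hA Xv (bv Yv)) rho_beta//.
have -> : (fun q => dir q (beta D Y q) p2) = fun q => -2 * gdot L Y zeta q.
  by apply/funext => q; rewrite dir_p2 ?rho_beta//; exact: bv.
have -> : (fun q => dir q (gamma X q) p2) = fun=> 0.
  apply/funext => q; rewrite dir_p2; last exact: gv.
  by rewrite rho_gamma gdot0l mulr0.
rewrite (dir_cst hB) -[dir u (gamma X u) _]/(vdf X _ u) (vdfMc hA); last first.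
  exact: (gdot_smooth hA hL).
rewrite /vdf dir_theta//; last exact: gv.
rewrite rho_gamma (gdot0r hA hL)//.
by abstract_scalars; lra.
Qed.

(** As T(X, zeta) = - vd X zeta, the symmetry of T and [theta_cov_gamma] show
    that this field is orthogonal to every field, in particular to itself. *)
Lemma vd_zeta X : pi_vfield X -> vd X zeta = fun=> 0.
Proof.
move=> Xv; have Xzv := vd_pv hA Xv zv; apply: (gdot_eq0 hL Xzv) => u.
have := congr1 (@^~ u) (cartan_T hC Xv zv Xzv); rewrite /= !Ttor_vd//.
rewrite !gdotBl theta_cov_gamma// (concurrent_v hz Xv).
rewrite [gdot L 0 _ _]gdot0l.
by abstract_scalars; lra.
Qed.

Lemma vdf_theta X Z u : pi_vfield X -> pi_vfield Z ->
  vdf X (gdot L Z zeta) u = gdot L (vd X Z) zeta u.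
Proof.
move=> Xv Zv; rewrite /vdf dir_theta//; last exact: gv.
by rewrite rho_gamma (gdot0r hA hL)// subr0 theta_cov_gamma.
Qed.

Lemma vdf_p2 X u : pi_vfield X -> vdf X p2 u = 0.
Proof. by move=> Xv; rewrite vdf_theta// vd_zeta// gdot0l. Qed.

Lemma p2_gt0 u : 0 < 1 + p2 u.
Proof. by rewrite ltr_pwDl// (gdot_ge0 hL). Qed.

Lemma dir_beta_theta X Z u : pi_vfield X -> pi_vfield Z ->
  dir u (beta D X u) (gdot L Z zeta) =
  gdot L (cov D (beta D X) Z) zeta u - gdot L Z X u.
Proof. by move=> Xv Zv; rewrite dir_theta ?rho_beta//; exact: bv. Qed.

End Concurrent.

End Cartan.

(** * The energy change *)

Section EnergyChange.
Context {R : realType} {n : nat} {M : Type} {A : atlas R n M}.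
Hypothesis hA : smooth_atlas A.
Local Notation B := (slit_atlas A).
Let hB : smooth_atlas B := slit_smooth_atlas hA.
Local Notation eta := (etabar A).
Let etav : pi_vfield eta := eta_pv hA.
Context (L : slit A -> R) (D : connection A) (zeta : slit A -> vec A)
  (Lt : slit A -> R) (Dt : connection A).
Hypotheses (hL : finsler L) (hC : cartan_connection L D) (hz : concurrent D zeta)
  (hLt : finsler Lt) (hCt : cartan_connection Lt Dt)
  (hchange : forall u, Lt u ^+ 2 = L u ^+ 2 + gdot L zeta eta u ^+ 2).
Let hD := cartan_linear hC.
Let hreg := cartan_regular hC.
Let hDt := cartan_linear hCt.
Let hregt := cartan_regular hCt.
Let zv : pi_vfield zeta := concurrent_pi_vfield hz.
Local Notation g := (gdot L).
Local Notation g' := (gdot Lt).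
Local Notation p2 := (gdot L zeta zeta).
Implicit Types (u : slit A) (X Y Z : slit A -> vec A) (V W : slit A -> vec B).

Let bv X : pi_vfield X -> vfield (beta D X) := beta_vf hA hD hreg (X := X).
Let bvt X : pi_vfield X -> vfield (beta Dt X) := beta_vf hA hDt hregt (X := X).
Let gv X : pi_vfield X -> vfield (gamma X) := gamma_vf hA (X := X).
Let vt V u : vfield V -> tangent u (V u) := fun Vv => vfield_tangent hB u Vv.

Lemma vdf_zeta_eta Z u : pi_vfield Z -> vdf Z (g zeta eta) u = g Z zeta u.
Proof.
move=> Zv; rewrite (vdf_gdot_eta hA hL)// (vd_zeta hA hL hC hz Zv) gdot0l.
by rewrite addr0.
Qed.

(** The vertical Hessian of B^2 / 2 is theta theta + B Hess B, and Hess B = 0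
    because dB = theta is constant along the fibres by [vdf_theta]. *)
Lemma gdot_change Y Z u : pi_vfield Y -> pi_vfield Z ->
  g' Y Z u = g Y Z u + g Y zeta u * g Z zeta u.
Proof.
move=> Yv Zv; have YZv := vd_pv hA Yv Zv.
have Ls := energy_smooth hA hL.
pose b := g zeta eta; have bs : smooth_fun B b by exact: (gdot_smooth hA hL).
have bbs : smooth_fun B (fun u => b u * b u) by exact: (smooth_funM hB).
have vE X w : pi_vfield X -> vdf X (fun t => Lt t ^+ 2) w =
    vdf X (fun t => L t ^+ 2) w + 2 * (b w * g X zeta w).
  move=> Xv; have -> : (fun t => Lt t ^+ 2) = fun t => L t ^+ 2 + b t * b t.
    by apply/funext => t; rewrite hchange expr2.
  rewrite (vdfD hA)// (vdfM hA)// /b vdf_zeta_eta//.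
  by abstract_scalars; ring.
rewrite (gdotE hA hLt)// (gdotE hA hL)// vE//.
have -> : vdf Z (fun t => Lt t ^+ 2) =
    fun w => vdf Z (fun t => L t ^+ 2) w + 2 * (b w * g Z zeta w).
  by apply/funext => w; rewrite vE.
have ts : smooth_fun B (g Z zeta) by exact: (gdot_smooth hA hL).
have bts : smooth_fun B (fun w => b w * g Z zeta w) by exact: (smooth_funM hB).
rewrite (vdfD hA); [|exact: vdf_smooth|]; last first.
  by apply: (smooth_funM hB) => //; exact: (smooth_fun_cst hB).
rewrite (vdfMc hA)// (vdfM hA)// /b vdf_zeta_eta// (vdf_theta hA hL hC hz)//.
by abstract_scalars; field.
Qed.

Lemma gdot_change_zeta Z u : pi_vfield Z -> g' Z zeta u = (1 + p2 u) * g Z zeta u.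
Proof. by move=> Zv; rewrite gdot_change//; abstract_scalars; ring. Qed.

(** By symmetry zeta may be moved to the last slot, where g'(Z, zeta) is
    (1 + p^2) g(Z, zeta), while zeta and p^2 are constant along the fibres. *)
Lemma vdg_change_zeta X Z u : pi_vfield X -> pi_vfield Z -> vdg Lt zeta X Z u = 0.
Proof.
move=> Xv Zv; have XZv := vd_pv hA Xv Zv.
rewrite (vdg_sym hA hLt)// (vdg_symr hA hLt)// /vdg (vd_zeta hA hL hC hz Xv).
rewrite (gdot0r hA hLt)// subr0 gdot_change_zeta//.
have -> : g' Z zeta = fun w => (1 + p2 w) * g Z zeta w.
  by apply/funext => w; rewrite gdot_change_zeta.
have ps := p2_smooth hA hL hz.
have cs : smooth_fun B (fun=> 1) by exact: (smooth_fun_cst hB).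
rewrite (vdfM hA); [|exact: (smooth_funD hB)|exact: (gdot_smooth hA hL)].
rewrite (vdfD hA)// (vdf_cst hA) (vdf_p2 hA hL hC hz)// (vdf_theta hA hL hC hz)//.
by abstract_scalars; ring.
Qed.

(** The tensor K' o beta, which by [K_change] is the difference of the two
    connection maps. *)
Definition dK X : slit A -> vec A := cov Dt (beta D X) eta.

Lemma dK_pv X : pi_vfield X -> pi_vfield (dK X).
Proof. by move=> Xv; apply: (cov_pv hA hDt) => //; exact: bv. Qed.

Lemma K_change V u : vfield V -> cov Dt V eta u = cov D V eta u + dK (rho V) u.
Proof.
move=> Vv; have rv := rho_pv hA Vv; have Kv := cov_pv hA hD Vv etav.
rewrite {1}/cov (hv_split hA hL hC u Vv) (connDl hDt)//.
- have := congr1 (@^~ u) (K_gamma hA hLt hCt Kv); rewrite {1}/cov => ->.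
  by rewrite addrC.
- by apply: vt; exact: bv.
- by apply: vt; exact: gv.
Qed.

Lemma beta_change X : pi_vfield X ->
  beta Dt X = fun u => beta D X u - gamma (dK X) u : vec B.
Proof.
move=> Xv; have dv := dK_pv Xv; apply/funext => u.
have bt : tangent u (beta D X u) by apply: vt; exact: bv.
have gt : tangent u (gamma (dK X) u) by apply: vt; exact: gv.
apply: (beta_unique hA hDt hregt); first exact: Xv.1.
  split; first exact: tangentB.
  rewrite (connBl hDt)//.
  have := congr1 (@^~ u) (K_gamma hA hLt hCt dv); rewrite {1}/cov => ->.
  by rewrite /dK /cov subrr.
have bX := congr1 (@^~ u) (rho_beta hA hC Xv); rewrite /rho in bX.
rewrite -bX; apply/funext => i; rewrite /dpi !fctE /= linearB /=.
by rewrite row_mxKl subr0.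
Qed.

Lemma dir_beta_change X f u : pi_vfield X ->
  dir u (beta Dt X u) f = dir u (beta D X u) f - vdf (dK X) f u.
Proof.
move=> Xv; rewrite beta_change// -scaleN1r addrC (dir_lin (B := B)).
by rewrite mulN1r addrC.
Qed.

Lemma rho_bracket_beta_change X V u : pi_vfield X -> vfield V ->
  rho (bracket (beta Dt X) V) u = rho (bracket (beta D X) V) u - vd (dK X) (rho V) u.
Proof.
move=> Xv Vv; have dv := dK_pv Xv; rewrite beta_change//.
rewrite -(rho_bracket_gamma hA dv Vv) {1}/rho (bracketBl hB)//; [|exact: bv|exact: gv].
by apply/funext => i; rewrite /rho /dpi !fctE /= linearB.
Qed.

Lemma rho_bracketC V W u : rho (bracket V W) u = - rho (bracket W V) u.
Proof.
by rewrite {1}/rho bracketC; apply/funext => i; rewrite /rho /dpi !fctE /= linearN.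
Qed.

Lemma rho_bracket_change X Z u : pi_vfield X -> pi_vfield Z ->
  rho (bracket (beta Dt X) (beta Dt Z)) u =
  rho (bracket (beta D X) (beta D Z)) u + vd (dK Z) X u - vd (dK X) Z u.
Proof.
move=> Xv Zv; rewrite rho_bracket_beta_change//; last exact: bvt.
rewrite (rho_beta hA hCt Zv) rho_bracketC rho_bracket_beta_change//; last exact: bv.
rewrite (rho_beta hA hC Xv) opprB [rho (bracket (beta D X) _) u]rho_bracketC.
by rewrite [vd (dK Z) X u - _]addrC.
Qed.

Lemma dir_beta_gdot_change X Y Z u : pi_vfield X -> pi_vfield Y -> pi_vfield Z ->
  dir u (beta D X u) (g' Y Z) =
  g' (cov D (beta D X) Y) Z u + g' Y (cov D (beta D X) Z) u
  - g Y X u * g Z zeta u - g Y zeta u * g Z X u.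
Proof.
move=> Xv Yv Zv.
have [cY cZ] := (cov_pv hA hD (bv Xv) Yv, cov_pv hA hD (bv Xv) Zv).
have -> : g' Y Z = fun w => g Y Z w + g Y zeta w * g Z zeta w.
  by apply/funext => w; rewrite gdot_change.
have s Y1 Z1 : pi_vfield Y1 -> pi_vfield Z1 -> smooth_fun B (g Y1 Z1).
  exact: (gdot_smooth hA hL).
have [s0 s1 s2] := And3 (s _ _ Yv Zv) (s _ _ Yv zv) (s _ _ Zv zv).
rewrite (dir_add hB u _ s0 (smooth_funM hB s1 s2)) (dir_mul hB u _ s1 s2).
have := dir_beta_theta hA hL hC hz u Xv Zv.
have := dir_beta_theta hA hL hC hz u Xv Yv.
have := cartan_metric hC (bv Xv) Yv Zv u.
rewrite !gdot_change//.
by abstract_scalars; move=> -> -> ->; ring.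
Qed.

(** The symmetry of D' on horizontal lifts, paired with eta. Each side is
    expanded by metricity, [D'_(beta' X) eta] and [D_(beta X) eta] being 0. *)
Lemma dK_antisym X Z u : pi_vfield X -> pi_vfield Z ->
  g' (dK X) Z u - g' (dK Z) X u = g Z eta u * g X zeta u - g X eta u * g Z zeta u.
Proof.
move=> Xv Zv; have [dXv dZv] := (dK_pv Xv, dK_pv Zv).
have E Y1 Y2 : pi_vfield Y1 -> pi_vfield Y2 ->
    g' (cov Dt (beta Dt Y1) Y2) eta u =
    g' (cov D (beta D Y1) Y2) eta u - g Y2 Y1 u * g eta zeta u
     - g Y2 zeta u * g eta Y1 u - g' (dK Y1) Y2 u - g' (vd (dK Y1) Y2) eta u.
  move=> Y1v Y2v; have dYv := dK_pv Y1v.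
  have := cartan_metric hCt (bvt Y1v) Y2v etav u.
  rewrite (K_beta hA hCt Y1v) (gdot0r hA hLt)// addr0 => <-.
  rewrite dir_beta_change// (vdf_gdot_eta hA hLt)// dir_beta_gdot_change//.
  rewrite (K_beta hA hC Y1v) (gdot0r hA hLt)//.
  by abstract_scalars; ring.
have : g' (fun w => cov Dt (beta Dt X) Z w - cov Dt (beta Dt Z) X w : vec A) eta u =
  g' (fun w => (cov D (beta D X) Z w - cov D (beta D Z) X w) + vd (dK Z) X w
     - vd (dK X) Z w : vec A) eta u.
  congr (gdot _ _ _ _); apply/funext => w.
  rewrite (cov_beta_sym hA hCt w Xv Zv) (cov_beta_sym hA hC w Xv Zv).
  exact: rho_bracket_change.
rewrite !(gdotBl, gdotDl) E// E//.
rewrite (gdotC hA hL _ etav Xv) (gdotC hA hL _ etav Zv) (gdotC hA hL _ Zv Xv).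
by abstract_scalars; lra.
Qed.

(** Metricity of D' along the spray beta' eta, where the torsion rewrites
    D'_(beta' eta) X as rho [beta' eta, beta' X]. *)
Lemma dK_sym X Z u : pi_vfield X -> pi_vfield Z ->
  g' (dK X) Z u + g' (dK Z) X u =
  - g X eta u * g Z zeta u - g X zeta u * g Z eta u - vdg Lt (dK eta) X Z u.
Proof.
move=> Xv Zv; have [dXv dZv] := (dK_pv Xv, dK_pv Zv); have dev := dK_pv etav.
have E Y w : pi_vfield Y -> cov Dt (beta Dt eta) Y w =
    cov D (beta D eta) Y w + dK Y w - vd (dK eta) Y w.
  move=> Yv; have := cov_beta_sym hA hCt w etav Yv.
  rewrite (K_beta hA hCt Yv) subr0 rho_bracket_change// -(cov_beta_sym hA hC w etav Yv).
  by rewrite (K_beta hA hC Yv) subr0 (vd_eta hA (dK_pv Yv)).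
have EF Y : pi_vfield Y -> cov Dt (beta Dt eta) Y = fun w =>
    cov D (beta D eta) Y w + dK Y w - vd (dK eta) Y w : vec A.
  by move=> Yv; apply/funext => w; exact: E.
have c Y : pi_vfield Y -> pi_vfield (cov D (beta D eta) Y).
  by move=> Yv; exact: (cov_pv hA hD (bv etav) Yv).
have v Y : pi_vfield Y -> pi_vfield (vd (dK eta) Y) by exact: (vd_pv hA).
have cd Y : pi_vfield Y -> pi_vfield (fun w => cov D (beta D eta) Y w + dK Y w : vec A).
  by move=> Yv; apply: (pvD hA); [exact: c|exact: dK_pv].
have := cartan_metric hCt (bvt etav) Xv Zv u.
rewrite dir_beta_change// dir_beta_gdot_change// !EF//.
rewrite gdotBl gdotDl (gdotBr hA hLt _ (cd _ Zv) (v _ Zv) Xv).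
rewrite (gdotDr hA hLt _ (c _ Zv) dZv Xv) (gdotC hA hLt _ Xv dZv) /vdg.
by abstract_scalars; lra.
Qed.

Lemma inv_smooth : smooth_fun B (fun w => (1 + p2 w)^-1).
Proof.
apply: (smooth_funV hB); first by move=> w; rewrite gt_eqF// (p2_gt0 hL hz).
by apply: (smooth_funD hB); [exact: (smooth_fun_cst hB)|exact: (p2_smooth hA hL hz)].
Qed.

Lemma coef_smooth X : pi_vfield X ->
  smooth_fun B (fun w => (1 + p2 w)^-1 * g X eta w).
Proof.
by move=> Xv; apply: (smooth_funM hB inv_smooth); exact: (gdot_smooth hA hL).
Qed.

(** Let W Y = dK Y + g(Y, eta) / (1 + p^2) zeta. By [dK_antisym] and [dK_sym]
    the form g'(W Y, Z) is symmetric and is - 1/2 vdg (dK eta) Y Z. For Y = eta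
    the right-hand side vanishes, so W eta = 0. Hence dK eta is a multiple of
    zeta, the right-hand side vanishes for every Y, and W = 0. *)
Lemma dKE X : pi_vfield X ->
  dK X = fun u => - ((1 + p2 u)^-1 * g X eta u) *: zeta u : vec A.
Proof.
pose c Y := fun w => (1 + p2 w)^-1 * g Y eta w.
pose W Y := fun w => dK Y w + c Y w *: zeta w : vec A.
have p0 w : 1 + p2 w != 0 by rewrite gt_eqF// (p2_gt0 hL hz).
have zc Y : pi_vfield Y -> pi_vfield (fun w => c Y w *: zeta w : vec A).
  by move=> Yv; apply: (pvZ hA) zv; exact: coef_smooth.
have Wv Y : pi_vfield Y -> pi_vfield (W Y).
  by move=> Yv; apply: (pvD hA); [exact: dK_pv|exact: zc].
have gW Y Z u : pi_vfield Y -> pi_vfield Z ->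
    g' (W Y) Z u = g' (dK Y) Z u + g Y eta u * g Z zeta u.
  move=> Yv Zv; rewrite gdotDl gdotZl (gdotC hA hLt _ zv Zv) gdot_change_zeta// /c.
  by congr (_ + _); rewrite mulrACA mulVf// mul1r.
have sW Y Z u : pi_vfield Y -> pi_vfield Z -> g' (W Y) Z u = g' (W Z) Y u.
  move=> Yv Zv; rewrite !gW//; have := dK_antisym u Yv Zv.
  by abstract_scalars; lra.
have aW Y Z u : pi_vfield Y -> pi_vfield Z ->
    2 * g' (W Y) Z u = - vdg Lt (dK eta) Y Z u.
  move=> Yv Zv; rewrite mulr2n mulrDl !mul1r {2}sW// !gW//.
  have := dK_sym u Yv Zv; abstract_scalars; generalize (vdg Lt (dK eta) Y Z u).
  by move=> *; lra.
have We0 : W eta = fun=> 0.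
  apply: (gdot_eq0 hLt (Wv _ etav)) => u; have := aW eta (W eta) u etav (Wv _ etav).
  rewrite (vdg_eta hA hLt)//; [|exact: dK_pv|exact: Wv].
  by abstract_scalars; lra.
have dKeta : dK eta = fun w => (- c eta w) *: zeta w : vec A.
  apply/funext => w; have := congr1 (@^~ w) We0; rewrite /W => /eqP.
  by rewrite addr_eq0 scaleNr => /eqP.
have W0 Y : pi_vfield Y -> W Y = fun=> 0.
  move=> Yv; apply: (gdot_eq0 hLt (Wv _ Yv)) => u.
  have := aW Y (W Y) u Yv (Wv _ Yv); rewrite dKeta (vdgZl hA hLt)//; last first.
  - exact: Wv.
  - have -> : (fun w => - c eta w) = fun w => -1 * c eta w.
      by apply/funext => w; rewrite mulN1r.
    apply: (smooth_funM hB); [exact: (smooth_fun_cst hB)|exact: coef_smooth].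
  rewrite vdg_change_zeta//; last exact: Wv.
  by abstract_scalars; lra.
move=> Xv; apply/funext => w; have := congr1 (@^~ w) (W0 X Xv); rewrite /W => /eqP.
by rewrite addr_eq0 scaleNr => /eqP.
Qed.

Lemma vdf_inv Y u : pi_vfield Y -> vdf Y (fun w => (1 + p2 w)^-1) u = 0.
Proof.
move=> Yv; have ps := p2_smooth hA hL hz.
have p0 w : 1 + p2 w != 0 by rewrite gt_eqF// (p2_gt0 hL hz).
have s1 := smooth_fun_cst hB 1; have qs := smooth_funD hB s1 ps.
have := vdfM hA Y u inv_smooth qs.
have -> : (fun w => (1 + p2 w)^-1 * (1 + p2 w)) = fun=> 1.
  by apply/funext => w; rewrite mulVf.
rewrite (vdf_cst hA) (vdfD hA)// (vdf_cst hA) (vdf_p2 hA hL hC hz)// addr0 mulr0 add0r.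
by move=> /esym/eqP; rewrite mulf_eq0 (negbTE (p0 u)) => /eqP.
Qed.

(** The derivative of the tensor [dK] along Y. As zeta and p^2 are constant along
    the fibres, only the factor g(X, eta) contributes. *)
Lemma vd_dK X Y u : pi_vfield X -> pi_vfield Y ->
  vd Y (dK X) u - dK (vd Y X) u = - ((1 + p2 u)^-1 * g X Y u) *: zeta u.
Proof.
move=> Xv Yv; have YXv := vd_pv hA Yv Xv.
have cs : smooth_fun B (fun w => - ((1 + p2 w)^-1 * g X eta w)).
  have -> : (fun w => - ((1 + p2 w)^-1 * g X eta w)) =
      fun w => -1 * ((1 + p2 w)^-1 * g X eta w).
    by apply/funext => w; rewrite mulN1r.
  by apply: (smooth_funM hB); [exact: (smooth_fun_cst hB)|exact: coef_smooth].
have E : vd Y (dK X) u = - ((1 + p2 u)^-1 * g X eta u) *: vd Y zeta u +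
    vdf Y (fun w => - ((1 + p2 w)^-1 * g X eta w)) u *: zeta u.
  by rewrite (dKE Xv); exact: (vdZr hA u Yv cs zv).
have z0 : vd Y zeta u = 0 by rewrite (vd_zeta hA hL hC hz Yv).
have dE : vdf Y (fun w => - ((1 + p2 w)^-1 * g X eta w)) u - - ((1 + p2 u)^-1 * g (vd Y X) eta u) =
    - ((1 + p2 u)^-1 * g X Y u).
  have -> : (fun w => - ((1 + p2 w)^-1 * g X eta w)) =
      fun w => -1 * ((1 + p2 w)^-1 * g X eta w).
    by apply/funext => w; rewrite mulN1r.
  have gs : smooth_fun B (g X eta) by exact: (gdot_smooth hA hL).
  rewrite (vdfMc hA); last exact: coef_smooth.
  rewrite (vdfM hA Y u inv_smooth gs) vdf_inv// (vdf_gdot_eta hA hL)//.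
  rewrite (gdotC hA hL _ Xv Yv).
  by generalize ((1 + p2 u)^-1); intro; abstract_scalars; ring.
have comb (U : lmodType R) (x y w z : U) (c d e f : R) :
    x = c *: y + d *: z -> y = 0 -> w = e *: z -> d - e = f -> x - w = f *: z.
  by move=> -> -> -> <-; rewrite scaler0 add0r scalerBl.
exact: comb E z0 (congr1 (@^~ u) (dKE YXv)) dE.
Qed.

(** By [berwaldE] the two connections differ by the vertical derivative of the
    tensor [dK]: the terms vd (dK X) Y coming from K' and from beta' cancel. *)
Lemma berwald_change V Y u : vfield V -> pi_vfield Y ->
  berwald Dt V Y u = berwald D V Y u - (g (rho V) Y u / (1 + p2 u)) *: zeta u.
Proof.
move=> Vv Yv; have Xv := rho_pv hA Vv; have dv := dK_pv Xv.
set X := rho V in Xv dv *.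
have [bvX bvtX gvY gvd] := And4 (bv Xv) (bvt Xv) (gv Yv) (gv dv).
rewrite (berwaldE hA hLt hCt u Vv Yv) (berwaldE hA hL hC u Vv Yv) -/X.
have KV : cov Dt V eta = fun w => cov D V eta w + dK X w : vec A.
  by apply/funext => w; exact: K_change.
have bb := bracket_vfield hB bvtX gvY.
have bb0 := bracket_vfield hB bvX gvY.
have bbg := bracket_vfield hB gvd gvY.
rewrite KV vdDl (K_change u bb).
have rE : rho (bracket (beta Dt X) (gamma Y)) = fun w => - vd Y X w : vec A.
  apply/funext => w; rewrite rho_bracketC (rho_bracket_gamma hA Yv bvtX).
  by rewrite (rho_beta hA hCt Xv).
have bE : bracket (beta Dt X) (gamma Y) u =
    bracket (beta D X) (gamma Y) u - bracket (gamma (dK X)) (gamma Y) u.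
  by rewrite beta_change// (bracketBl hB).
have cE : cov D (bracket (beta Dt X) (gamma Y)) eta u =
    cov D (bracket (beta D X) (gamma Y)) eta u - (vd (dK X) Y u - vd Y (dK X) u).
  have wv : pi_vfield (fun w => vd (dK X) Y w - vd Y (dK X) w : vec A).
    by apply: (pvB hA); exact: (vd_pv hA).
  have := congr1 (@^~ u) (K_gamma hA hL hC wv); rewrite -(bracket_gamma hA dv Yv) => <-.
  by rewrite /cov bE (connBl hD)//; exact: vt.
have dN : dK (fun w => - vd Y X w : vec A) u = - dK (vd Y X) u.
  have YXv := vd_pv hA Yv Xv; rewrite !dKE//; last exact: (pvN hA).
  by rewrite gdotNl mulrN opprK scaleNr opprK.
have fin : vd Y (dK X) u - dK (vd Y X) u = - ((g X Y u / (1 + p2 u)) *: zeta u).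
  by rewrite (vd_dK u Xv Yv) scaleNr mulrC.
have comb (U : zmodType) (a b c d e x y z : U) :
    x = c - (b - d) -> y = - e -> d - e = - z -> a + b + (x + y) = a + c - z.
  move=> -> -> <-; rewrite opprB addrA [c + _]addrC -!addrA; congr (_ + _).
  by rewrite [d + (- b + _)]addrCA addNKr addrCA.
exact: comb cE (etrans (congr1 (fun F => dK F u) rE) dN) fin.
Qed.

(** In [berwaldE] the bracket only sees the base part of beta' X, which is X,
    while K (beta' X) = - dK X is a multiple of zeta. *)
Lemma berwald_beta_change X Y u : pi_vfield X -> pi_vfield Y ->
  berwald D (beta Dt X) Y u =
  berwald D (beta D X) Y u + (g X eta u / (1 + p2 u)) *: berwald D (gamma zeta) Y u.
Proof.
move=> Xv Yv; have dv := dK_pv Xv.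
rewrite (berwaldE hA hL hC u (bvt Xv) Yv) (berwaldE hA hL hC u (bv Xv) Yv).
rewrite (berwaldE hA hL hC u (gv zv) Yv).
rewrite (rho_beta hA hC Xv) (rho_beta hA hCt Xv) (K_beta hA hC Xv) (K_gamma hA hL hC zv).
rewrite rho_gamma.
have b0 : beta D (fun=> 0 : vec A) = fun=> 0 : vec B.
  apply/funext => w; apply: (beta_unique hA hD hreg); first exact: (pv0 hA).1.
    by split; [exact: tangent0|apply: (conn0l hD)].
  by apply/funext => i; rewrite /dpi linear0.
have br0 : bracket (beta D (fun=> 0 : vec A)) (gamma Y) u = 0.
  have b0v := bv (pv0 hA).
  have := bracketBl hB u b0v b0v (gv Yv); rewrite subrr => <-.
  by congr (bracket _ _ u); apply/funext => w; rewrite subrr b0.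
have c0 : cov D (bracket (beta D (fun=> 0 : vec A)) (gamma Y)) eta u = 0.
  exact: etrans (congr1 (fun xi => D u xi eta) br0) (conn0l hD u etav).
have Kt : cov D (beta Dt X) eta = fun w => (g X eta w / (1 + p2 w)) *: zeta w : vec A.
  apply/funext => w; have := K_change w (bvt Xv).
  rewrite (K_beta hA hCt Xv) (rho_beta hA hCt Xv) dKE// => /esym/eqP.
  by rewrite addr_eq0 scaleNr opprK mulrC => /eqP.
have v0 : vd (fun=> 0 : vec A) Y u = 0.
  have -> : (fun=> 0 : vec A) = fun w => 0 *: zeta w.
    by apply/funext => w; rewrite scale0r.
  by rewrite vdZl scale0r.
have vK : vd (cov D (beta Dt X) eta) Y u = (g X eta u / (1 + p2 u)) *: vd zeta Y u.
  by rewrite Kt; exact: (vdZl zeta (fun w => g X eta w / (1 + p2 w))).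
have comb (U : lmodType R) (x y z w c : U) (k : R) :
    x = k *: z -> y = 0 -> w = 0 -> x + c = y + c + k *: (z + w).
  by move=> -> -> ->; rewrite add0r addr0 addrC.
exact: comb vK v0 c0.
Qed.

End EnergyChange.

Lemma smooth_manifold_atlas (R : realType) (n : nat) (M : topologicalType)
    (A : atlas R n M) : smooth_manifold A -> smooth_atlas A.
Proof.
move=> hM; split; first exact: dom_chart_at hM.
- exact: coord_inj hM.
- move=> i j; apply: (coord_open hM (i := i)); last by move=> p [].
  by apply: openI; exact: dom_open hM _.
- exact: transition_smooth hM.
Qed.

Theorem theorem5p20 (R : realType) (n : nat) (M : topologicalType)
    (A : atlas R n M) (hM : smooth_manifold A)
    (L : slit A -> R) (hL : finsler L)
    (nabla : connection A) (hnabla : cartan_connection L nabla)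
    (zeta : slit A -> vec A) (hzeta : concurrent nabla zeta)
    (Lt : slit A -> R) (hLt : finsler Lt)
    (hchange : forall u, Lt u ^+ 2 = L u ^+ 2 + gdot L zeta (etabar A) u ^+ 2)
    (nablat : connection A) (hnablat : cartan_connection Lt nablat) :
  let p2 := gdot L zeta zeta in
  let D0 := berwald nabla in
  let Dt0 := berwald nablat in
  let U0 := fun (X Y : slit A -> vec A) (u : slit A) =>
    (gdot L X Y u / (1 + p2 u)) *: zeta u
    - (gdot L X (etabar A) u / (1 + p2 u)) *: D0 (gamma zeta) Y u in
  (forall X Y : slit A -> vec (slit_atlas A), vfield X -> vfield Y ->
     forall u, Dt0 X (rho Y) u =
       D0 X (rho Y) u - (gdot L (rho X) (rho Y) u / (1 + p2 u)) *: zeta u) /\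
  (forall X Y : slit A -> vec A, pi_vfield X -> pi_vfield Y ->
     (forall u, Dt0 (gamma X) Y u = D0 (gamma X) Y u) /\
     (forall u, Dt0 (beta nablat X) Y u =
        D0 (beta nabla X) Y u - U0 X Y u)).
Proof.
move=> p2 D0 Dt0 U0; have hA := smooth_manifold_atlas hM.
have zv := concurrent_pi_vfield hzeta.
have hD := cartan_linear hnabla; have hreg := cartan_regular hnabla.
have hDt := cartan_linear hnablat; have hregt := cartan_regular hnablat.
have main X Y u : vfield X -> pi_vfield Y ->
    Dt0 X Y u = D0 X Y u - (gdot L (rho X) Y u / (1 + p2 u)) *: zeta u.
  move=> Xv Yv; exact: (berwald_change hA hL hnabla hzeta hLt hnablat hchange).
split=> [X Y Xv Yv u|X Y Xv Yv]; first by apply: main => //; exact: rho_pv.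
split=> u.
  rewrite main//; last exact: gamma_vf.
  by rewrite rho_gamma gdot0l mul0r scale0r subr0.
rewrite main//; last exact: (beta_vf hA hDt hregt).
rewrite (rho_beta hA hnablat Xv) /D0.
rewrite (berwald_beta_change hA hL hnabla hzeta hLt hnablat hchange u Xv Yv).
by rewrite /U0 opprB -!addrA; congr (_ + _); rewrite addrC.
Qed.
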